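(* (Maximum Modulus Principle) Let $S_{g,n}$ be a compact oriented surface of genus $g\ge 0$ with $n\geq 1$ holes and let $\mathcal D=\{V,E,F\}$ be a finite polygonal cellular decomposition of it, $V=V^{\partial}\sqcup V^{\circ}$. Let $\hat{\mathbf T}:V^{\circ}\to\mathbb R_+$ satisfy $\sum_{v\in Q}\hat{\mathbf T}(v)<\sum_{f\in F_Q}\pi\min\{N(f,Q),N(f)-2\}$ for every nonempty $Q\subset V^{\circ}$ (with $F_Q$ the set of faces having a vertex in $Q$, $N(f)=\#V(f)$, $N(f,Q)=\#(V(f)\cap Q)$). Let $\mathbf k,\mathbf k':V\to\mathbb R_+$ be the geodesic curvature vectors of two generalized circle packings associated with $\mathcal D$ such that $\mathbf k(w)\le\mathbf k'(w)$ for every $w\in V^{\partial}$ and $\mathbf T_{\mathbf k}(v)=\mathbf T_{\mathbf k'}(v)=\hat{\mathbf T}(v)$ for every $v\in V^{\circ}$. Define $\phi:V\to\mathbb R_+$ by $\phi(v)=\mathbf k'(v)/\mathbf k(v)$ and let $M$ be the maximal value of $\phi$. Then: (a) $M\ge1$; (b) if $M>1$, then $M$ is attained only at boundary vertices $w\in V^{\partial}$; (c) if $M$ is attained at some interior vertex, then $M=1$ and hence $\mathbf k=\mathbf k'$.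
   Context: Finite polygonal cellular decomposition: $\mathcal D=\{V,E,F\}$, where $V,E,F$ are finite collections of 0-, 1-, 2-cells on $S_{g,n}$ such that (I) each 0-cell is an endpoint of at least three 1-cells; (II) two 1-cells do not intersect except possibly at endpoints; (III) the boundary of each 2-cell consists of at least three 1-cells, two distinct 2-cells that intersect do so in a 1-cell (or a 0-cell), and the union of all 2-cells is $S_{g,n}$; (IV) every boundary component of $S_{g,n}$ contains at least three 0-cells. The 1-skeleton is a simple graph. $V^{\partial}$ is the set of vertices on $\partial S_{g,n}$, $V^{\circ}=V\setminus V^{\partial}$; $V(f)$ is the vertex set of the face $f$. $\mathbb R_+=(0,\infty)$. Generalized circles: a generalized circle in $\mathbb H^2$ is a hyperbolic circle (geodesic curvature $k>1$, radius $\operatorname{arccoth}k$), a horocycle ($k=1$), or a hypercycle ($0<k<1$), i.e. a component of the set of points at distance $\operatorname{arctanh}k$ from a geodesic called its axis. The total geodesic curvature of an arc of length $\ell$ is $T=k\ell$. Generalized circle configuration: cyclically ordered generalized circles $C_1,\dots,C_m$ ($m\ge3$) in $\mathbb H^2$ such that consecutive ones are externally tangent at one point, non-consecutive ones are disjoint and no three meet at a common point, the configuration bounds a convex region with nonempty interior (compact apart from possible ideal vertices at centers of horocycles), and there is a hyperbolic circle $C_P$ (the dual circle) of curvature $k_P>1$ containing all tangency points and perpendicular to all $C_i$. It is known that for each $(k_1,\dots,k_m)\in\mathbb R_+^m$ there is a unique such configuration up to isometry with $C_i$ of curvature $k_i$; $k_P$ is determined by $\sum_i\theta_i=2\pi$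 with $\theta_i\in(0,\pi)$, $\cot(\theta_i/2)=k_i/\sqrt{k_P^2-1}$. The interstice $\Omega_f$ is the region bounded by the arcs of $C_1,\dots,C_m$ between consecutive tangency points, lying inside $C_P$. Generalized circle packing associated with $\mathcal D$: a collection $\{C_v\}_{v\in V}$ such that, for each face $f$, the circles at the vertices of $f$ form a generalized circle configuration. Each $\mathbf k\in\mathbb R_+^{V}$ determines exactly one packing up to isometry, with $C_v$ of curvature $\mathbf k(v)$. For $v\in V(f)$ let $T_{v,f}$ be the total geodesic curvature of the side of $\Omega_f$ on $C_v$; then $\mathbf T_{\mathbf k}(v)=\sum_{f\ni v}T_{v,f}$. Explicitly, with $k=\mathbf k(v)$ and $k_P$ the dual curvature of $f$: $T_{v,f}=\frac{2k}{\sqrt{k^2-1}}\operatorname{arccot}\frac{k_P}{\sqrt{k^2-1}}$ if $k>1$; $2/k_P$ if $k=1$; $\frac{2k}{\sqrt{1-k^2}}\operatorname{arccoth}\frac{k_P}{\sqrt{1-k^2}}$ if $0<k<1$. *)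

(* Defs.v *)
From HB Require Import structures.
From mathcomp Require Import all_boot all_order all_algebra.
From mathcomp Require Import all_classical all_reals all_analysis.

Set Implicit Arguments.
Unset Strict Implicit.
Unset Printing Implicit Defensive.

Import Order.TTheory GRing.Theory Num.Theory numFieldNormedType.Exports.

Local Open Scope classical_set_scope.
Local Open Scope ring_scope.

Definition vec (R : realType) := 'rV[R]_3.

Definition mink (R : realType) (x y : vec R) : R :=
  x 0 1 * y 0 1 + x 0 2%:R * y 0 2%:R - x 0 0 * y 0 0.

Definition hplane (R : realType) : set (vec R) :=
  [set x | mink x x = -1 /\ 0 < x 0 0].

Definition arcosh (R : realType) (t : R) : R := ln (t + Num.sqrt (t ^+ 2 - 1)).
Definition arcoth (R : realType) (t : R) : R := ln ((t + 1) / (t - 1)) / 2.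
Definition artanh (R : realType) (t : R) : R := ln ((1 + t) / (1 - t)) / 2.

Definition hdist (R : realType) (x y : vec R) : R := arcosh (- mink x y).

Definition hdist_set (R : realType) (x : vec R) (A : set (vec R)) : R :=
  inf [set hdist x y | y in A].

(* Geodesic segment between x and y.  Either argument may be any positive
   multiple of a point of the plane, or a future null vector, which stands for
   an ideal point; the segment is then a ray or a line. *)
Definition hsegment (R : realType) (x y : vec R) : set (vec R) :=
  [set z | hplane z /\
    exists s t : R, [/\ 0 <= s, 0 <= t & z = s *: x + t *: y]].

(* The geodesic with unit spacelike normal n. *)
Definition hgeodesic (R : realType) (n : vec R) : set (vec R) :=
  [set x | hplane x /\ mink n x = 0].

(* [HCircle c k] is the circle of center c and radius arccoth k.  [Horocycle n]
   is the horocycle at the ideal point spanned by the future null vector n (all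
   of them are obtained by rescaling n).  [Hypercycle n k] is the component, on
   the side to which n points, of the set of points at distance arctanh k from
   the geodesic with unit normal n; the other component is
   [Hypercycle (- n) k]. *)
Inductive gcircle (R : realType) : Type :=
  | HCircle of vec R & R
  | Horocycle of vec R
  | Hypercycle of vec R & R.

Definition gc_wf (R : realType) (C : gcircle R) : Prop :=
  match C with
  | HCircle c k => hplane c /\ 1 < k
  | Horocycle n => mink n n = 0 /\ 0 < n 0 0
  | Hypercycle n k => [/\ mink n n = 1, 0 < k & k < 1]
  end.

Definition gc_curv (R : realType) (C : gcircle R) : R :=
  match C with
  | HCircle _ k => k
  | Horocycle _ => 1
  | Hypercycle _ k => k
  end.

Definition gc_set (R : realType) (C : gcircle R) : set (vec R) :=
  match C with
  | HCircle c k => [set x | hplane x /\ hdist c x = arcoth k]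
  | Horocycle n => [set x | hplane x /\ mink n x = -1]
  | Hypercycle n k => [set x | [/\ hplane x, 0 < mink n x
                                 & hdist_set x (hgeodesic n) = artanh k]]
  end.

(* The open convex side: disk, horodisk, or the side containing the axis. *)
Definition gc_disk (R : realType) (C : gcircle R) : set (vec R) :=
  match C with
  | HCircle c k => [set x | hplane x /\ hdist c x < arcoth k]
  | Horocycle n => [set x | hplane x /\ -1 < mink n x]
  | Hypercycle n k => [set x | hplane x /\
      (mink n x <= 0 \/ hdist_set x (hgeodesic n) < artanh k)]
  end.

Definition is_horocycle (R : realType) (C : gcircle R) : Prop :=
  if C is Horocycle _ then True else False.

(* Every generalized circle is a level set of [mink (gc_pole C)] on the plane,
   so the pole determines its tangent lines. *)
Definition gc_pole (R : realType) (C : gcircle R) : vec R :=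
  match C with
  | HCircle c _ => c
  | Horocycle n => n
  | Hypercycle n _ => n
  end.

Definition gc_tangent (R : realType) (C : gcircle R) (p v : vec R) : Prop :=
  mink p v = 0 /\ mink (gc_pole C) v = 0.

Definition perpendicular (R : realType) (C D : gcircle R) : Prop :=
  gc_set C `&` gc_set D !=set0 /\
  forall p v w, (gc_set C `&` gc_set D) p ->
    gc_tangent C p v -> gc_tangent D p w -> mink v w = 0.

Definition externally_tangent_at (R : realType) (C D : gcircle R) (p : vec R)
    : Prop :=
  gc_set C `&` gc_set D = [set p] /\ gc_disk C `&` gc_disk D = set0.

(* Where the normal to C through p meets the center of C, resp. its ideal
   center, resp. its axis (up to a positive factor). *)
Definition gc_foot (R : realType) (C : gcircle R) (p : vec R) : vec R :=
  match C with
  | HCircle c _ => c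
  | Horocycle n => n
  | Hypercycle n _ => p - mink p n *: n
  end.

Definition hball (R : realType) (x : vec R) (e : R) : set (vec R) :=
  [set y | hplane y /\ hdist x y < e].

Definition hinterior (R : realType) (K : set (vec R)) : set (vec R) :=
  [set x | hplane x /\ exists2 e : R, 0 < e & hball x e `<=` K].

Definition hfrontier (R : realType) (K : set (vec R)) : set (vec R) :=
  [set x | hplane x /\ forall e : R, 0 < e ->
     hball x e `&` K !=set0 /\ hball x e `\` K !=set0].

Definition hconvex (R : realType) (K : set (vec R)) : Prop :=
  forall x y, K x -> K y -> hsegment x y `<=` K.

Definition velocity (R : realType) (gam : R -> vec R) (t : R) : vec R :=
  \row_i derive1 (fun s : R => gam s 0 i) t.

(* A is an arc of length l from p to q: it has an injective C^1
   parametrization by arc length on [0, l]. *)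
Definition is_arc_of_length (R : realType) (A : set (vec R)) (p q : vec R)
    (l : R) : Prop :=
  0 <= l /\
  exists gam : R -> vec R,
    [/\ gam 0 = p /\ gam l = q,
        forall t i, 0 <= t <= l -> derivable (fun s : R => gam s 0 i) t 1,
        forall i, {within `[0, l]%classic,
                   continuous (fun t : R => velocity gam t 0 i)},
        forall t, 0 <= t <= l -> mink (velocity gam t) (velocity gam t) = 1
      & (forall s t, 0 <= s <= l -> 0 <= t <= l -> gam s = gam t -> s = t) /\
        A = [set gam t | t in `[0, l]%classic]].

(* The polygon whose sides are the geodesic segments joining the (possibly
   ideal) centers of consecutive circles through their tangency points, stopped
   at the axes of the hypercycles, together with the segments of these axes in
   between.  [p i] is the tangency point of [C i] and [C (ordS i)]. *)
Definition configuration_boundary (R : realType) (m : nat)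
    (C : 'I_m -> gcircle R) (p : 'I_m -> vec R) : set (vec R) :=
  \bigcup_(i in [set: 'I_m])
    (hsegment (p i) (gc_foot (C i) (p i)) `|`
     hsegment (p i) (gc_foot (C (ordS i)) (p i)) `|`
     hsegment (gc_foot (C (ordS i)) (p i)) (gc_foot (C (ordS i)) (p (ordS i)))).

Definition bounds_convex_region (R : realType) (m : nat)
    (C : 'I_m -> gcircle R) (p : 'I_m -> vec R) : Prop :=
  exists K : set (vec R),
    [/\ K `<=` @hplane R /\ hfrontier K `<=` K,
        hconvex K,
        hinterior K !=set0,
        compact (K `\` \bigcup_(i in [set i | is_horocycle (C i)]) gc_disk (C i))
      & hfrontier K = configuration_boundary C p].

Record gc_configuration (R : realType) (m : nat) (C : 'I_m -> gcircle R)
    (p : 'I_m -> vec R) (dual : gcircle R) : Prop := GCConfiguration {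
  conf_size : (3 <= m)%N;
  conf_wf : forall i, gc_wf (C i);
  conf_tangent : forall i, externally_tangent_at (C i) (C (ordS i)) (p i);
  conf_disjoint : forall i j, j != i -> j != ordS i -> i != ordS j ->
    gc_set (C i) `&` gc_set (C j) = set0;
  conf_no_triple : forall i j l, i != j -> j != l -> i != l ->
    gc_set (C i) `&` gc_set (C j) `&` gc_set (C l) = set0;
  conf_region : bounds_convex_region C p;
  conf_dual_wf : gc_wf dual;
  conf_dual_curv : 1 < gc_curv dual;
  conf_dual_tangency : forall i, gc_set dual (p i);
  conf_dual_perp : forall i, perpendicular dual (C i)
}.

(* The side on C of the interstice: the arc of C inside the dual circle. *)
Definition interstice_side (R : realType) (C dual : gcircle R) : set (vec R) :=
  gc_set C `&` (gc_disk dual `|` gc_set dual).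

(* Combinatorial map of the closed surface of genus g obtained from S_{g,n} by
   capping its n holes with disks.  A dart x is an oriented 1-cell with origin
   [vert x]; [edge x] is the same 1-cell with the opposite orientation, and
   [face x] is the next dart along the boundary of the region on the left of x.
   That region is [cell x], either a 2-cell of the decomposition or one of the n
   capping disks.  0-cells are the orbits of the rotation [face \o edge]. *)
Record cell_decomposition (g n : nat) : Type := CellDecomposition {
  dart : finType;
  vertex : finType;
  facet : finType;
  edge : dart -> dart;
  face : dart -> dart;
  vert : dart -> vertex;
  cell : dart -> facet + 'I_n;
  edgeK : involutive edge;
  edge_neq : forall x, edge x != x;
  face_inj : injective face;
  vertP : forall x y, (vert x == vert y) = fconnect (face \o edge) x y;
  vert_onto : forall v, exists x, vert x = v;
  cellP : forall x y, (cell x == cell y) = fconnect face x y;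
  cell_onto : forall c, exists x, cell x = c;
  connectedP : forall x y,
    connect [rel a b | (b == edge a) || (b == face a)] x y;
  (* there are #|dart| / 2 1-cells *)
  eulerP : #|vertex|%:Z - (#|dart|./2)%:Z + #|facet|%:Z = 2 - 2 * g%:Z - n%:Z;
  (* the boundary components of S_{g,n} are disjoint simple closed curves *)
  hole_simple : forall x y (i j : 'I_n),
    cell x = inr i -> cell y = inr j -> vert x = vert y -> x = y;
  (* the 1-skeleton is a simple graph *)
  no_loop : forall x, vert x != vert (edge x);
  no_multi : forall x y,
    vert x = vert y -> vert (edge x) = vert (edge y) -> x = y;
  degree_ge3 : forall v, (3 <= #|[set x | vert x == v]%SET|)%N;
  (* 2-cells are (embedded) polygons with at least three sides *)
  facet_simple : forall x y (f : facet),
    cell x = inl f -> cell y = inl f -> vert x = vert y -> x = y;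
  facet_ge3 : forall f : facet, (3 <= #|[set x | cell x == inl f]%SET|)%N;
  (* distinct 2-cells meet in nothing, a 0-cell or a 1-cell *)
  facet_meet : forall f f' : facet, f != f' ->
    let W := ([set vert x | x in dart & cell x == inl f] :&:
              [set vert x | x in dart & cell x == inl f'])%SET in
    (#|W| <= 1)%N \/
    exists x, [/\ cell x = inl f, cell (edge x) = inl f'
                & W = [set vert x; vert (edge x)]%SET];
  hole_ge3 : forall i : 'I_n, (3 <= #|[set x | cell x == inr i]%SET|)%N
}.

Section DecompositionDefs.
Variables (g n : nat) (D : cell_decomposition g n).

Definition boundary_vertices : {set vertex D} :=
  [set v | [exists x : dart D,
     (vert x == v) && [exists i : 'I_n, cell x == inr i]]]%SET.

Definition interior_vertices : {set vertex D} := (~: boundary_vertices)%SET.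

Definition facet_vertices (f : facet D) : {set vertex D} :=
  [set vert x | x in dart D & cell x == inl f]%SET.

End DecompositionDefs.

(* The metric on the surface is glued from the polygons bounded by the
   configurations of the 2-cells, so a packing with curvatures k consists of one
   configuration in the hyperbolic plane for each 2-cell f, listed along the
   boundary of f, in which the circle at v has curvature [k v].
   For a dart x on f, [pk_circle x] is the circle at [vert x] in the
   configuration of f, [pk_tangency x] its tangency point with the next circle,
   and [pk_length x] the length of the side of the interstice on
   [pk_circle x].  The values on darts bordering a hole are irrelevant. *)
Record gc_packing (R : realType) (g n : nat) (D : cell_decomposition g n)
    (k : vertex D -> R) : Type := GCPacking {
  pk_circle : dart D -> gcircle R;
  pk_tangency : dart D -> vec R;
  pk_dual : facet D -> gcircle R;
  pk_length : dart D -> R;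
  pk_curvP : forall x f, cell x = inl f -> gc_curv (pk_circle x) = k (vert x);
  pk_confP : forall x f, cell x = inl f ->
    gc_configuration
      (fun i : 'I_(fingraph.order (@face g n D) x) =>
         pk_circle (iter i (@face g n D) x))
      (fun i : 'I_(fingraph.order (@face g n D) x) =>
         pk_tangency (iter i (@face g n D) x))
      (pk_dual f);
  pk_lengthP : forall x f, cell x = inl f ->
    is_arc_of_length (interstice_side (pk_circle (face x)) (pk_dual f))
      (pk_tangency x) (pk_tangency (face x)) (pk_length (face x))
}.

(* T_{v,f}; for v in f the sum has exactly one term, the corner of f at v. *)
Definition side_curvature (R : realType) (g n : nat)
    (D : cell_decomposition g n) (k : vertex D -> R) (P : gc_packing k)
    (v : vertex D) (f : facet D) : R :=
  \sum_(x : dart D | (vert x == v) && (cell x == inl f))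
     gc_curv (pk_circle P x) * pk_length P x.

Definition total_curvature (R : realType) (g n : nat)
    (D : cell_decomposition g n) (k : vertex D -> R) (P : gc_packing k)
    (v : vertex D) : R :=
  \sum_(f : facet D | v \in facet_vertices f) side_curvature P v f.

(* Main.v *)
(**
  In the hyperboloid model a generalized circle of curvature [k] is the level set
  [<N, x> = - k] of a vector with [<N, N> = 1 - k^2], and its convex side is
  [<N, x> > - k].  Put [s = sqrt (kP^2 - 1)] for the curvature [kP] of the dual
  circle of a face.  Tangency and orthogonality to the dual circle show that
  consecutive tangency points differ by the rotation of angle
  [2 atan (s / k_i)] about the center of the dual circle, always in the same
  direction; disjointness of the circles prevents the rotation from winding
  twice, so [sum_i atan (s / k_i) = pi].  Integrating the geodesic
  curvature equation gives the side length [l = 2 Phi(1 / kP)] with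
  [Phi' (x) = 1 / (1 + (k^2 - 1) x^2)] and [Phi 0 = 0].

  If [k' <= M k] on a face, the angle equation forces [s' <= M s].  At a vertex
  where [k' = M k] the total curvature [k l] is nonincreasing in [s], and it
  increases strictly when [k] and [s] are both multiplied by [M > 1].  Hence a
  maximum [M > 1] of [k' / k] cannot sit at an interior vertex, where the total
  curvatures agree.  When the maximum is [1], the same argument applied to [k / k']
  gives [k = k'].
*)
Require Import Defs.
From HB Require Import structures.
From mathcomp Require Import all_boot all_order all_algebra.
From mathcomp Require Import all_classical all_reals all_analysis.
From mathcomp Require Import ring lra.

Set Implicit Arguments.
Unset Strict Implicit.
Unset Printing Implicit Defensive.

Import Order.TTheory GRing.Theory Num.Theory numFieldNormedType.Exports.

Local Open Scope classical_set_scope.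
Local Open Scope ring_scope.

(** * Minkowski space *)

Section Minkowski.
Context {R : realType}.
Implicit Types (x y z v c p q N : vec R) (a b k s K : R).

(** Lorentzian cross product: the Euclidean one with its time coordinate negated, so that
    [mink (mcross x y) z] is the determinant of [x], [y], [z]. *)
Definition mcross x y : vec R :=
  \row_i [:: x 0 2%:R * y 0 1 - x 0 1 * y 0 2%:R;
             x 0 2%:R * y 0 0 - x 0 0 * y 0 2%:R;
             x 0 0 * y 0 1 - x 0 1 * y 0 0]`_i.

Lemma mcrossE x y :
  [/\ mcross x y 0 0 = x 0 2%:R * y 0 1 - x 0 1 * y 0 2%:R,
      mcross x y 0 1 = x 0 2%:R * y 0 0 - x 0 0 * y 0 2%:R
    & mcross x y 0 2%:R = x 0 0 * y 0 1 - x 0 1 * y 0 0].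
Proof. by rewrite !mxE. Qed.

Lemma vec3P x y :
  x 0 0 = y 0 0 -> x 0 1 = y 0 1 -> x 0 2%:R = y 0 2%:R -> x = y.
Proof.
move=> e0 e1 e2; apply/rowP => -[[|[|[|//]]] i3].
- by rewrite (_ : Ordinal i3 = 0) //; apply/val_inj.
- by rewrite (_ : Ordinal i3 = 1) //; apply/val_inj.
- by rewrite (_ : Ordinal i3 = 2%:R) //; apply/val_inj.
Qed.

Lemma minkC x y : mink x y = mink y x.
Proof. by rewrite /mink; ring. Qed.

Lemma minkDl x y z : mink (x + y) z = mink x z + mink y z.
Proof. by rewrite /mink !mxE; ring. Qed.

Lemma minkZl a x y : mink (a *: x) y = a * mink x y.
Proof. by rewrite /mink !mxE; ring. Qed.

Lemma minkNl x y : mink (- x) y = - mink x y.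
Proof. by rewrite /mink !mxE; ring. Qed.

Lemma minkBl x y z : mink (x - y) z = mink x z - mink y z.
Proof. by rewrite /mink !mxE; ring. Qed.

Lemma minkDr x y z : mink x (y + z) = mink x y + mink x z.
Proof. by rewrite /mink !mxE; ring. Qed.

Lemma minkZr a x y : mink x (a *: y) = a * mink x y.
Proof. by rewrite /mink !mxE; ring. Qed.

Lemma minkNr x y : mink x (- y) = - mink x y.
Proof. by rewrite /mink !mxE; ring. Qed.

Lemma minkBr x y z : mink x (y - z) = mink x y - mink x z.
Proof. by rewrite /mink !mxE; ring. Qed.

Definition minkE := (minkDl, minkBl, minkZl, minkNl, minkDr, minkBr, minkZr, minkNr).

Lemma mink_crossl x y : mink (mcross x y) x = 0.
Proof. by rewrite /mink; have [-> -> ->] := mcrossE x y; ring. Qed.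

Lemma mink_crossr x y : mink (mcross x y) y = 0.
Proof. by rewrite /mink; have [-> -> ->] := mcrossE x y; ring. Qed.

Lemma mink_cross x y z v :
  mink (mcross x y) (mcross z v) = mink x v * mink y z - mink x z * mink y v.
Proof.
rewrite /mink; have [-> -> ->] := mcrossE x y; have [-> -> ->] := mcrossE z v.
by ring.
Qed.

Lemma mcrossDr x y z : mcross x (y + z) = mcross x y + mcross x z.
Proof. by apply: vec3P; rewrite !mxE /=; ring. Qed.

Lemma mcrossZr a x y : mcross x (a *: y) = a *: mcross x y.
Proof. by apply: vec3P; rewrite !mxE /=; ring. Qed.

Lemma mink_crossA x y z : mink (mcross x y) z = mink x (mcross y z).
Proof.
rewrite /mink; have [-> -> ->] := mcrossE x y; have [-> -> ->] := mcrossE y z.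
by ring.
Qed.

Lemma mcrossC x y : mcross x y = - mcross y x.
Proof. by apply: vec3P; rewrite !mxE /=; ring. Qed.

Lemma mcross_mcross x y z :
  mcross x (mcross y z) = mink x y *: z - mink x z *: y.
Proof. by apply: vec3P; rewrite /mink !mxE /=; ring. Qed.

(** A squared determinant against minus the Gram determinant; the sign appears because the form
    [mink] has determinant -1. *)
Lemma gram3 x y z :
  mink (mcross x y) z ^+ 2 =
  mink x x * mink y z ^+ 2 + mink y y * mink x z ^+ 2 + mink z z * mink x y ^+ 2
  - mink x x * mink y y * mink z z - 2 * mink x y * mink x z * mink y z.
Proof. by rewrite /mink; have [-> -> ->] := mcrossE x y; ring. Qed.

(** With [q = mcross x y], the triple product formula gives [mcross q v = 0]; expanding
    [mcross q (mcross q v)] yields the identity. It is left undivided because [mink q q] can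
    vanish. *)
Lemma perp_cross x y v : mink v x = 0 -> mink v y = 0 ->
  mink (mcross x y) (mcross x y) *: v = mink v (mcross x y) *: mcross x y.
Proof.
move=> vx vy; set q := mcross x y.
have qv : mcross q v = 0.
  by rewrite mcrossC mcross_mcross vx vy !scale0r subrr oppr0.
have : mcross q (mcross q v) = 0.
  by rewrite qv; apply: vec3P; rewrite !mxE /=; ring.
by rewrite mcross_mcross => /eqP; rewrite subr_eq0 => /eqP ->; rewrite minkC.
Qed.

(** Euclidean Cauchy-Schwarz bounds the spatial part, and [key] shows that the time coordinates
    dominate. *)
Lemma reverse_cauchy_schwarz x y : mink x x < 0 -> mink y y < 0 -> 0 < x 0 0 -> 0 < y 0 0 ->
  mink x y <= - Num.sqrt (mink x x * mink y y).
Proof.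
rewrite /mink; set x0 := x 0 0; set x1 := x 0 1; set x2 := x 0 2%:R.
set y0 := y 0 0; set y1 := y 0 1; set y2 := y 0 2%:R => xx yy px py.
have gap : (x1 * y1 + x2 * y2) ^+ 2 <= (x1 ^+ 2 + x2 ^+ 2) * (y1 ^+ 2 + y2 ^+ 2).
  have := sqr_ge0 (x1 * y2 - x2 * y1); lra.
have le : x1 * y1 + x2 * y2 <= Num.sqrt ((x1 ^+ 2 + x2 ^+ 2) * (y1 ^+ 2 + y2 ^+ 2)).
  by rewrite (le_trans (ler_norm _))// -sqrtr_sqr ler_wsqrtr.
set a := x1 ^+ 2 + x2 ^+ 2 in gap le *; set b := y1 ^+ 2 + y2 ^+ 2 in gap le *.
have a0 : 0 <= a by rewrite addr_ge0 ?sqr_ge0.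
have b0 : 0 <= b by rewrite addr_ge0 ?sqr_ge0.
have xx' : a < x0 ^+ 2 by rewrite /a; lra.
have yy' : b < y0 ^+ 2 by rewrite /b; lra.
have -> : (x1 * x1 + x2 * x2 - x0 * x0) * (y1 * y1 + y2 * y2 - y0 * y0) =
          (x0 ^+ 2 - a) * (y0 ^+ 2 - b) by rewrite /a /b; ring.
(* After squaring, this is the inequality of arithmetic and geometric means for [a * (y0 ^+ 2 - b)]
   and [b * (x0 ^+ 2 - a)]. *)
have key : Num.sqrt (a * b) + Num.sqrt ((x0 ^+ 2 - a) * (y0 ^+ 2 - b)) <= x0 * y0.
  have xy0 : 0 <= x0 * y0 by rewrite mulr_ge0 ?ltW.
  rewrite -(ler_pXn2r (n := 2)) // ?nnegrE ?addr_ge0 ?sqrtr_ge0 //.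
  have ab0 : 0 <= a * b by rewrite mulr_ge0.
  have cd0 : 0 <= (x0 ^+ 2 - a) * (y0 ^+ 2 - b) by rewrite mulr_ge0 // subr_ge0 ltW.
  rewrite sqrrD !sqr_sqrtr // -mulr_natr -sqrtrM //.
  have : Num.sqrt (a * b * ((x0 ^+ 2 - a) * (y0 ^+ 2 - b))) * 2 <=
         a * (y0 ^+ 2 - b) + b * (x0 ^+ 2 - a).
    have h0 : 0 <= a * (y0 ^+ 2 - b) + b * (x0 ^+ 2 - a).
      by rewrite addr_ge0 // mulr_ge0 // subr_ge0 ltW.
    rewrite -ler_pdivlMr // -[leRHS]ger0_norm ?divr_ge0 // -sqrtr_sqr.
    apply: ler_wsqrtr.
    have := sqr_ge0 ((a * (y0 ^+ 2 - b) - b * (x0 ^+ 2 - a)) / 2); lra.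
  by lra.
by lra.
Qed.

End Minkowski.

(** * Generalized circles as level sets *)

Section GeneralizedCircles.
Context {R : realType}.
Implicit Types (x y n : vec R) (C : gcircle R) (t k : R).

Lemma inf_minimum (A : set R) t : A t -> lbound A t -> inf A = t.
Proof.
move=> At lbt; apply/eqP; rewrite eq_le; apply/andP; split.
  by apply: ge_inf At; exists t.
by apply: lb_le_inf => //; exists t.
Qed.

Lemma ltr_arcosh : {in [pred t : R | 1 <= t] &, {mono @arcosh R : s t / s < t}}.
Proof.
apply/leW_mono_in/le_mono_in => s t; rewrite !inE => s1 t1 st.
have sq1 (r : R) : 1 <= r -> 0 <= r ^+ 2 - 1.
  by move=> r1; rewrite subr_ge0 expr_ge1 // (le_trans ler01).
have pos (r : R) : 1 <= r -> 0 < r + Num.sqrt (r ^+ 2 - 1).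
  by move=> r1; rewrite ltr_pwDl ?sqrtr_ge0 // (lt_le_trans ltr01).
rewrite /arcosh ltr_ln ?posrE ?pos // ltr_leD //.
by rewrite ler_wsqrtr // lerB // ler_pXn2r ?nnegrE ?(le_trans ler01) // ltW.
Qed.

Lemma arcosh_inj : {in [pred t : R | 1 <= t] &, injective (@arcosh R)}.
Proof.
move=> s t s1 t1 st; apply/eqP; rewrite eq_le !leNgt.
by rewrite -(ltr_arcosh s1 t1) -(ltr_arcosh t1 s1) st !ltxx.
Qed.

(** Turns a radius into an [arcosh], so that monotonicity of [arcosh] reduces conditions on [hdist]
    to conditions on [mink]; [arcosh_artanh] does the same for hypercycles. *)
Lemma arcosh_arcoth k : 1 < k -> arcosh (k / Num.sqrt (k ^+ 2 - 1)) = arcoth k.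
Proof.
move=> k1; have r2 : 0 < k ^+ 2 - 1 by rewrite subr_gt0 exprn_egt1.
set r := Num.sqrt _; have r0 : 0 < r by rewrite sqrtr_gt0.
have rr : r ^+ 2 = k ^+ 2 - 1 by rewrite sqr_sqrtr // ltW.
have -> : arcosh (k / r) = ln ((k + 1) / r).
  rewrite /arcosh (_ : (k / r) ^+ 2 - 1 = r^-1 ^+ 2).
    rewrite sqrtr_sqr gtr0_norm ?invr_gt0 //; congr ln.
    by field; rewrite gt_eqF.
  rewrite !expr_div_n exprVn rr; field; rewrite gt_eqF //.
apply: (mulIf (_ : 2 != 0)) => //; rewrite divfK // mulr_natr.
rewrite -lnXn ?divr_gt0 //; last by lra.
congr ln; rewrite expr_div_n rr; field; apply/andP; split; lra.
Qed.

Lemma arcosh_artanh k : 0 < k -> k < 1 ->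
  arcosh (Num.sqrt (1 - k ^+ 2))^-1 = artanh k.
Proof.
move=> k0 k1; have r2 : 0 < 1 - k ^+ 2 by rewrite subr_gt0 exprn_ilt1 // ltW.
set r := Num.sqrt _; have r0 : 0 < r by rewrite sqrtr_gt0.
have rr : r ^+ 2 = 1 - k ^+ 2 by rewrite sqr_sqrtr // ltW.
have -> : arcosh r^-1 = ln ((1 + k) / r).
  rewrite /arcosh (_ : r^-1 ^+ 2 - 1 = (k / r) ^+ 2).
    rewrite sqrtr_sqr gtr0_norm ?divr_gt0 //; congr ln.
    by field; rewrite gt_eqF.
  rewrite !expr_div_n exprVn rr; field; rewrite gt_eqF //.
apply: (mulIf (_ : 2 != 0)) => //; rewrite divfK // mulr_natr.
rewrite -lnXn ?divr_gt0 //; last by lra.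
congr ln; rewrite expr_div_n rr; field; apply/andP; split; lra.
Qed.

(** Were [y] in the past cone, the reverse Cauchy-Schwarz inequality for [x] and [- y] would make
    [mink x y] nonnegative. *)
Lemma mink_future x y : hplane x -> mink y y < 0 -> mink x y < 0 -> 0 < y 0 0.
Proof.
move=> [xx x0] yy xy; rewrite ltNge; apply/negP; rewrite le_eqVlt => /predU1P[y0|y0].
  move: yy; rewrite /mink y0 mulr0 subr0 ltNge => /negP; apply.
  by rewrite -!expr2 addr_ge0 ?sqr_ge0.
have := @reverse_cauchy_schwarz _ x (- y); rewrite xx !minkE opprK ltrN10 => /(_ isT yy x0).
rewrite !mxE oppr_gt0 => /(_ y0) h.
by have := sqrtr_ge0 (-1 * mink y y); lra.
Qed.

Lemma hdist_ge1 x y : hplane x -> hplane y -> 1 <= - mink x y.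
Proof.
move=> [xx x0] [yy y0]; have := @reverse_cauchy_schwarz _ x y.
by rewrite xx yy mulrNN mulr1 sqrtr1 ltrN10 lerNr; apply.
Qed.

(** The nearest point is the normalized projection [x' = x - a *: n]. Minimality is the reverse
    Cauchy-Schwarz inequality for [x'] and [y], since [mink x' y = mink x y] for [y] on the
    geodesic. *)
Lemma hdist_hgeodesic n x : mink n n = 1 -> hplane x ->
  hdist_set x (hgeodesic n) = arcosh (Num.sqrt (1 + mink n x ^+ 2)).
Proof.
move=> nn hx; have [xx x0] := hx; set a := mink n x.
have r2 : 0 < 1 + a ^+ 2 by rewrite ltr_pwDl ?sqr_ge0.
set r := Num.sqrt _; have r0 : 0 < r by rewrite sqrtr_gt0.
have rr : r ^+ 2 = 1 + a ^+ 2 by rewrite sqr_sqrtr // ltW.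
have r1 : 1 <= r by rewrite -sqrtr1 ler_wsqrtr // lerDl sqr_ge0.
pose x' := x - a *: n.
have xx' : mink x' x' = - (r ^+ 2).
  by rewrite rr /x' !minkE (minkC x n) nn xx -/a; ring.
have nx' : mink n x' = 0 by rewrite /x' !minkE nn -/a; ring.
have x'x : mink x x' = - (r ^+ 2) by rewrite rr /x' !minkE (minkC x n) xx -/a; ring.
have x'y y : mink n y = 0 -> mink x' y = mink x y.
  by move=> ny; rewrite /x' minkBl minkZl ny mulr0 subr0.
have x'0 : 0 < x' 0 0.
  by apply: (mink_future hx); rewrite ?xx' ?x'x oppr_lt0 exprn_gt0.
clearbody x'; apply: inf_minimum.
  exists (r^-1 *: x').
    split; last by rewrite minkZr nx' mulr0.
    split; last by rewrite !mxE mulr_gt0 ?invr_gt0.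
    by rewrite !minkE xx'; field; rewrite gt_eqF.
  by rewrite /hdist; congr arcosh; rewrite !minkE x'x; field; rewrite gt_eqF.
move=> _ [y [[yy y0] ny] <-]; rewrite /hdist.
have : r <= - mink x y.
  have := @reverse_cauchy_schwarz _ x' y.
  rewrite xx' yy mulrNN mulr1 sqrtr_sqr gtr0_norm // oppr_lt0 exprn_gt0 // ltrN10.
  by rewrite x'y // lerNr; apply.
move=> ry; rewrite leNgt ltr_arcosh -?leNgt // inE // (le_trans r1) //.
Qed.

(* The pole rescaled so that every generalized circle of curvature [k] is
   [mink N x = - k], with [mink N N = 1 - k ^+ 2]. *)
Definition gc_normal C : vec R :=
  match C with
  | HCircle c k => Num.sqrt (k ^+ 2 - 1) *: c
  | Horocycle n => n
  | Hypercycle n k => - Num.sqrt (1 - k ^+ 2) *: n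
  end.

Lemma mink_gc_normal C : gc_wf C ->
  mink (gc_normal C) (gc_normal C) = 1 - gc_curv C ^+ 2.
Proof.
case: C => [c k [[cc _] k1]|n [nn _]|n k [nn k0 k1]] /=; rewrite ?minkE.
- rewrite cc mulrN1 mulrN -expr2 sqr_sqrtr ?subr_ge0 ?exprn_ege1 // ?ltW //; ring.
- by rewrite nn expr1n subrr.
- by rewrite nn mulr1 mulrNN -expr2 sqr_sqrtr // subr_ge0 exprn_ile1 // ltW.
Qed.

Lemma mink_gc_pole0 C x : gc_wf C -> mink (gc_pole C) x = 0 <-> mink (gc_normal C) x = 0.
Proof.
case: C => [c k [_ k1]|n _|n k [_ k0 k1]] //=; rewrite !minkE.
  have r0 : 0 < Num.sqrt (k ^+ 2 - 1) by rewrite sqrtr_gt0 subr_gt0 exprn_egt1.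
  by split=> [->|/eqP]; rewrite ?mulr0 // mulf_eq0 gt_eqF //= => /eqP.
have r0 : 0 < Num.sqrt (1 - k ^+ 2) by rewrite sqrtr_gt0 subr_gt0 exprn_ilt1 // ltW.
by split=> [->|/eqP]; rewrite ?mulr0 // mulf_eq0 oppr_eq0 gt_eqF //= => /eqP.
Qed.

Let coth_ge1 k : 1 < k -> 1 <= k / Num.sqrt (k ^+ 2 - 1).
Proof.
move=> k1; have r0 : 0 < Num.sqrt (k ^+ 2 - 1) by rewrite sqrtr_gt0 subr_gt0 exprn_egt1.
rewrite ler_pdivlMr // mul1r -[leRHS]gtr0_norm ?(lt_trans ltr01) // -sqrtr_sqr.
by rewrite ler_wsqrtr // gerBl.
Qed.

Let sqrt_gt0 k : 0 < k -> k < 1 -> 0 < Num.sqrt (1 - k ^+ 2).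
Proof. by move=> k0 k1; rewrite sqrtr_gt0 subr_gt0 exprn_ilt1 // ltW. Qed.

(** Here [mink n x] is the hyperbolic sine of the distance to the axis, so a comparison of
    hyperbolic cosines becomes, after squaring, one of hyperbolic sines. *)
Lemma hypercycle_lt n x k : mink n n = 1 -> hplane x -> 0 < mink n x -> 0 < k -> k < 1 ->
  (hdist_set x (hgeodesic n) < artanh k) = (Num.sqrt (1 - k ^+ 2) * mink n x < k).
Proof.
move=> nn hx a0 k0 k1; have r0 := sqrt_gt0 k0 k1.
rewrite hdist_hgeodesic // -arcosh_artanh //; set a := mink n x in a0 *.
have a2 : 0 <= a ^+ 2 by rewrite sqr_ge0.
have q1 : 1 <= Num.sqrt (1 + a ^+ 2) by rewrite -[leLHS]sqrtr1 ler_wsqrtr // lerDl.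
have r1 : Num.sqrt (1 - k ^+ 2) <= 1.
  by rewrite -[leRHS]sqrtr1 ler_wsqrtr // gerBl sqr_ge0.
rewrite ltr_arcosh ?inE ?invf_ge1 // -[X in _ < X]mul1r ltr_pdivlMr //.
rewrite -[RHS](ltr_pXn2r (n := 2)) ?nnegrE ?mulr_ge0 ?sqrtr_ge0 // ?ltW //.
rewrite -[LHS](ltr_pXn2r (n := 2)) ?nnegrE ?mulr_ge0 ?sqrtr_ge0 // !exprMn.
have h1 : 0 <= 1 + a ^+ 2 by rewrite addr_ge0.
have h2 : 0 <= 1 - k ^+ 2 by rewrite ltW // -sqrtr_gt0.
rewrite !sqr_sqrtr //.
by apply/idP/idP; lra.
Qed.

Lemma hypercycle_eq n x k : mink n n = 1 -> hplane x -> 0 < mink n x -> 0 < k -> k < 1 ->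
  hdist_set x (hgeodesic n) = artanh k <-> Num.sqrt (1 - k ^+ 2) * mink n x = k.
Proof.
move=> nn hx a0 k0 k1; have r0 := sqrt_gt0 k0 k1.
rewrite hdist_hgeodesic // -arcosh_artanh //; set a := mink n x in a0 *.
have a2 : 0 <= a ^+ 2 by rewrite sqr_ge0.
have q1 : 1 <= Num.sqrt (1 + a ^+ 2) by rewrite -[leLHS]sqrtr1 ler_wsqrtr // lerDl.
have qq : Num.sqrt (1 + a ^+ 2) ^+ 2 = 1 + a ^+ 2 by rewrite sqr_sqrtr ?addr_ge0.
have r1 : Num.sqrt (1 - k ^+ 2) <= 1.
  by rewrite -[leRHS]sqrtr1 ler_wsqrtr // gerBl sqr_ge0.
have rr : Num.sqrt (1 - k ^+ 2) ^+ 2 = 1 - k ^+ 2.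
  by rewrite sqr_sqrtr // ltW // -sqrtr_gt0.
split=> [/arcosh_inj|e].
  rewrite !inE invf_ge1 // => /(_ q1 r1) e.
  apply/eqP; rewrite -(eqrXn2 (n := 2)) // ?mulr_ge0 ?ltW //; apply/eqP.
  move/(congr1 (fun u => u ^+ 2)): e; rewrite exprMn qq exprVn rr => e.
  have -> : a ^+ 2 = (1 - k ^+ 2)^-1 - 1 by rewrite -e; ring.
  by field; rewrite -rr expf_neq0 // gt_eqF.
congr arcosh; apply: (mulIf (lt0r_neq0 r0)); rewrite mulVf ?lt0r_neq0 //.
apply/eqP; rewrite -(eqrXn2 (n := 2)) // ?mulr_ge0 ?sqrtr_ge0 //; apply/eqP.
rewrite exprMn qq expr1n mulrDl -exprMn mulrC (mulrC a) mulr1 e; lra.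
Qed.

Lemma gc_setP C x : gc_wf C -> hplane x ->
  gc_set C x <-> mink (gc_normal C) x = - gc_curv C.
Proof.
move=> wf hx; case: C wf => [c k [hc k1]|n _|n k [nn k0 k1]] /=.
- have r0 : 0 < Num.sqrt (k ^+ 2 - 1) by rewrite sqrtr_gt0 subr_gt0 exprn_egt1.
  rewrite minkE -(arcosh_arcoth k1) /hdist.
  split=> [[_ /arcosh_inj]|e].
    rewrite !inE coth_ge1 // hdist_ge1 // => /(_ isT isT) /eqP.
    by rewrite eqr_oppLR => /eqP ->; field; rewrite gt_eqF.
  split=> //; congr arcosh; apply: (mulfI (lt0r_neq0 r0)).
  by rewrite mulrN e opprK; field; rewrite gt_eqF.
- by split=> [[]|].
- rewrite minkE mulNr; split=> [[_ a0 /(hypercycle_eq nn hx a0 k0 k1)-> //]|/oppr_inj e].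
  have a0 : 0 < mink n x by rewrite -(pmulr_rgt0 _ (sqrt_gt0 k0 k1)) e.
  by split=> //; apply/hypercycle_eq.
Qed.

Lemma gc_diskP C x : gc_wf C -> hplane x ->
  gc_disk C x <-> - gc_curv C < mink (gc_normal C) x.
Proof.
move=> wf hx; case: C wf => [c k [hc k1]|n _|n k [nn k0 k1]] /=.
- have r0 : 0 < Num.sqrt (k ^+ 2 - 1) by rewrite sqrtr_gt0 subr_gt0 exprn_egt1.
  have hd : (hdist c x < arcoth k) = (- k < Num.sqrt (k ^+ 2 - 1) * mink c x).
    rewrite -arcosh_arcoth // /hdist ltr_arcosh ?inE ?coth_ge1 ?hdist_ge1 //.
    by rewrite ltr_pdivlMr // mulrC mulrN ltrNl.
  by rewrite minkE -hd; split=> [[]|].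
- by split=> [[]|].
- rewrite minkE mulNr ltrN2; have r0 := sqrt_gt0 k0 k1.
  (* Where [mink n x <= 0] the inequality is automatic, since [0 < k]; only on the other side does
     the distance to the axis decide. *)
  split=> [[_ [a0|]]|lt].
  + by rewrite (le_lt_trans _ k0) // pmulr_rle0.
  + have [a0 _|a0] := leP (mink n x) 0; last by rewrite hypercycle_lt.
    by rewrite (le_lt_trans _ k0) // pmulr_rle0.
  + split=> //; have [a0|a0] := leP (mink n x) 0; [by left|right].
    by rewrite hypercycle_lt.
Qed.

End GeneralizedCircles.

(** * Derivatives and the generalized arctangent *)

Section RealDerivatives.
Context {R : realType}.
Implicit Types (f g : R -> R) (a b c l x : R).

(** The derivative rules are restated for pointwise functions, so that they chain by application and
    the derivative of a composite is computed by unification. *)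
Lemma derD f g x a b : is_derive x 1 f a -> is_derive x 1 g b ->
  is_derive x 1 (fun t => f t + g t) (a + b).
Proof. by move=> fa gb; exact: is_deriveD. Qed.

Lemma derB f g x a b : is_derive x 1 f a -> is_derive x 1 g b ->
  is_derive x 1 (fun t => f t - g t) (a - b).
Proof. by move=> fa gb; exact: is_deriveB. Qed.

Lemma derM f g x a b : is_derive x 1 f a -> is_derive x 1 g b ->
  is_derive x 1 (fun t => f t * g t) (a * g x + f x * b).
Proof.
move=> fa gb; have := is_deriveM fa gb; move/is_derive_eq; apply.
by rewrite addrC; congr (_ + _); exact: mulrC.
Qed.

Lemma der_cst c x : is_derive x 1 (fun=> c) (0 : R).
Proof. exact: is_derive_cst. Qed.

Lemma derZ f c x a : is_derive x 1 f a -> is_derive x 1 (fun t => c * f t) (c * a).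
Proof.
move=> fa; have := derM (der_cst c x) fa; move/is_derive_eq; apply.
by rewrite mul0r add0r.
Qed.

Lemma derV f x a : f x != 0 -> is_derive x 1 f a ->
  is_derive x 1 (fun t => (f t)^-1) (- (f x ^- 2 * a)).
Proof.
move=> f0 fa; have := is_deriveV f0 fa; move/is_derive_eq; apply.
exact: mulNr.
Qed.

Lemma der_comp f g x a b : is_derive (g x) 1 f a -> is_derive x 1 g b ->
  is_derive x 1 (fun t => f (g t)) (a * b).
Proof. exact: is_derive1_comp. Qed.

Lemma der_continuous f (df : R -> R) a b :
  (forall x, x \in `[a, b] -> is_derive x 1 f (df x)) ->
  {within `[a, b], continuous f}.
Proof.
by move=> fd; apply: derivable_within_continuous => x /fd [].
Qed.

Lemma MVT_segment f (df : R -> R) a b : a < b ->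
  (forall x, x \in `[a, b] -> is_derive x 1 f (df x)) ->
  exists2 c, c \in `]a, b[ & f b - f a = df c * (b - a).
Proof.
move=> ab fd.
have fd' x : x \in `]a, b[ -> is_derive x 1 f (df x).
  by move=> xab; exact: fd (subset_itv_oo_cc xab).
have fc := der_continuous fd.
exact: (MVT ab fd' fc).
Qed.

(** Difference quotients from the right are nonnegative. One side suffices, which is what is
    available at an endpoint of a parametrized arc. *)
Lemma der_ge0_right f x l a : x < l -> (forall t, x <= t <= l -> f x <= f t) ->
  is_derive x 1 f a -> 0 <= a.
Proof.
move=> xl fx [df <-].
have cv : h^-1 *: (f (h *: 1 + x) - f x) @[h --> 0^'+] --> 'D_1 f x.
  by apply: cvg_dnbhs_at_right; exact: df.
rewrite -(cvg_lim _ cv) //; apply: limr_ge; first by apply/cvg_ex; exists ('D_1 f x).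
near=> h; rewrite /= mulr_ge0 // ?invr_ge0 ?subr_ge0; first by near: h; exact: nbhs_right_ge.
apply: fx; rewrite [h *: 1]mulr1 lerDr; apply/andP; split.
  by near: h; exact: nbhs_right_ge.
rewrite -lerBrDr; near: h; apply: nbhs_right_le; rewrite subr_gt0 //.
Unshelve. all: by end_near. Qed.

Lemma der_le0_left f x l a : l < x -> (forall t, l <= t <= x -> f x <= f t) ->
  is_derive x 1 f a -> a <= 0.
Proof.
move=> lx fx fa; rewrite -oppr_ge0.
apply: (@der_ge0_right (fun t => f (- t)) (- x) (- l)); first by rewrite ltrN2.
  by move=> t /andP[lo hi]; rewrite opprK; apply: fx; rewrite lerNr hi lerNl lo.
have dN : is_derive (- x) 1 (fun t : R => - t) (- 1) by exact: is_deriveNid.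
have fa' : is_derive (- (- x)) 1 f a by rewrite opprK.
by have := der_comp fa' dN; rewrite mulrN1.
Qed.

(** Applying the one-sided sign lemmas to [f] and [- f] also covers the endpoints, beyond which [f]
    is not known to be constant: from the right if [x < l], from the left if [x = l]. *)
Lemma der_const f c x l a : 0 < l -> (forall t, 0 <= t <= l -> f t = c) ->
  0 <= x <= l -> is_derive x 1 f a -> a = 0.
Proof.
move=> l0 fc /andP[x0 xl] fa; have fx : f x = c by apply: fc; rewrite x0.
have nfa : is_derive x 1 (fun t => -1 * f t) (-1 * a) by exact: derZ.
apply/eqP; rewrite eq_le; have [xl'|lx] := ltP x l.
  have ft t : x <= t <= l -> f t = c.
    by move=> /andP[xt tl]; apply: fc; rewrite tl (le_trans x0).
  rewrite (der_ge0_right xl' _ fa); last by move=> t /ft ->; rewrite fx.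
  rewrite andbT -oppr_ge0 -mulN1r (der_ge0_right xl' _ nfa) // => t /ft ->.
  by rewrite fx.
have {}xl : x = l by apply/eqP; rewrite eq_le xl.
have ft t : 0 <= t <= x -> f t = c by rewrite xl; exact: fc.
have {}x0 : 0 < x by rewrite xl.
rewrite (der_le0_left x0 _ fa) /=; last by move=> t /ft ->; rewrite fx.
rewrite -oppr_le0 -mulN1r (der_le0_left x0 _ nfa) // => t /ft ->.
by rewrite fx.
Qed.

Lemma continuous_away_gt f a b c : a <= b -> {within `[a, b], continuous f} ->
  (forall x, x \in `[a, b] -> f x != c) -> c < f a -> c < f b.
Proof.
move=> ab fc fn ca; rewrite ltNge; apply/negP => bc.
have [|x xab fx] := @IVT _ f a b c ab fc.
  by rewrite ge_min bc orbT le_max ltW.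
by have := fn x xab; rewrite fx eqxx.
Qed.

End RealDerivatives.

(** * The generalized arctangent and its behavior under dilation *)

Section Arctn.
Context {R : realType}.
Implicit Types kappa a k s x : R.

(* The inverse of the generalized tangent [tan (sqrt kappa * t) / sqrt kappa],
   i.e. the integral of [1 / (1 + kappa y^2)] from [0] to [x]. *)
Definition arctn kappa x : R :=
  if 0 < kappa then atan (Num.sqrt kappa * x) / Num.sqrt kappa
  else if kappa == 0 then x
  else (ln (1 + Num.sqrt (- kappa) * x) - ln (1 - Num.sqrt (- kappa) * x))
       / (2 * Num.sqrt (- kappa)).

Lemma arctn0 kappa : arctn kappa 0 = 0.
Proof.
rewrite /arctn; case: ifP => _; first by rewrite mulr0 atan0 mul0r.
by case: ifP => // _; rewrite mulr0 addr0 subr0 subrr mul0r.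
Qed.

Lemma is_derive_arctn kappa x : 0 < 1 + kappa * x ^+ 2 ->
  is_derive x 1 (arctn kappa) (1 + kappa * x ^+ 2)^-1.
Proof.
move=> pos; have lin c : is_derive x 1 (fun y => c * y) c.
  by have := derZ c (is_derive_id x (1 : R)); rewrite mulr1.
have [k0|k0|k0] := ltrgtP kappa 0.
- have -> : arctn kappa = fun y => (2 * Num.sqrt (- kappa))^-1 *
      (ln (1 + Num.sqrt (- kappa) * y) - ln (1 - Num.sqrt (- kappa) * y)).
    by apply/funext => y; rewrite /arctn ltNge ltW //= lt_eqF // mulrC.
  set a := Num.sqrt (- kappa); have a0 : 0 < a by rewrite sqrtr_gt0 oppr_gt0.
  have aa : a ^+ 2 = - kappa by rewrite sqr_sqrtr // oppr_ge0 ltW.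
  (* For negative [kappa] the hypothesis says that [a * x] lies in []-1, 1[], so both logarithms
     have positive arguments. *)
  have : (a * x) ^+ 2 < 1 by rewrite exprMn aa; lra.
  rewrite -[ltRHS](expr1n _ 2) -ltr_sqrt ?exprn_gt0 // !sqrtr_sqr normr1 ltr_norml.
  move=> /andP[lo hi]; have p1 : 0 < 1 + a * x by lra.
  have p2 : 0 < 1 - a * x by lra.
  have d1 := @der_comp _ _ (fun y => 1 + a * y) x _ _ (is_derive1_ln p1)
    (derD (der_cst 1 x) (lin a)).
  have d2 := @der_comp _ _ (fun y => 1 - a * y) x _ _ (is_derive1_ln p2)
    (derB (der_cst 1 x) (lin a)).
  have := derZ (2 * a)^-1 (derB d1 d2); move/is_derive_eq; apply.
  have -> : 1 + kappa * x ^+ 2 = (1 + a * x) * (1 - a * x).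
    by rewrite -[kappa]opprK -aa; ring.
  by field; rewrite !gt_eqF.
- have -> : arctn kappa = fun y => (Num.sqrt kappa)^-1 * atan (Num.sqrt kappa * y).
    by apply/funext => y; rewrite /arctn k0 mulrC.
  have a0 : 0 < Num.sqrt kappa by rewrite sqrtr_gt0.
  have := derZ (Num.sqrt kappa)^-1 
    (@der_comp _ _ (fun y => Num.sqrt kappa * y) x _ _ (is_derive1_atan _)
      (lin (Num.sqrt kappa))).
  move/is_derive_eq; apply; rewrite exprMn sqr_sqrtr ?ltW //.
  by field; rewrite !gt_eqF.
- have -> : arctn kappa = id by apply/funext => y; rewrite /arctn k0 ltxx eqxx.
  by rewrite k0 mul0r addr0 invr1; exact: is_derive_id.
Qed.

(** The expression is [(1 - x ^+ 2) + k ^+ 2 * x ^+ 2], two nonnegative terms that do not vanish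
    together. *)
Let unit_pos k x : 0 < k -> 0 <= x <= 1 -> 0 < 1 + (k ^+ 2 - 1) * x ^+ 2.
Proof.
move=> k0 /andP[x0 x1]; have k2 : 0 < k ^+ 2 by rewrite exprn_gt0.
have x2 : 0 <= x ^+ 2 by rewrite sqr_ge0.
have : x ^+ 2 <= 1 by rewrite expr_le1.
by nra.
Qed.

Lemma ler_arctn k x y : 0 < k -> 0 <= x -> x <= y -> y <= 1 ->
  arctn (k ^+ 2 - 1) x <= arctn (k ^+ 2 - 1) y.
Proof.
move=> k0 x0; rewrite le_eqVlt => /predU1P[-> //|xy] y1.
have dd t : t \in `[x, y] ->
    is_derive t 1 (arctn (k ^+ 2 - 1)) (1 + (k ^+ 2 - 1) * t ^+ 2)^-1.
  rewrite in_itv /= => /andP[xt ty]; apply/is_derive_arctn/unit_pos => //.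
  by rewrite (le_trans x0) // (le_trans ty).
have [c cxy] := MVT_segment xy dd.
move/eqP; rewrite subr_eq => /eqP ->; rewrite lerDr mulr_ge0 ?subr_ge0 ?(ltW xy) //.
move: cxy; rewrite in_itv /= => /andP[xc cy].
by rewrite invr_ge0 ltW // unit_pos // (le_trans x0) ?ltW // (lt_le_trans cy).
Qed.

(* In the variable [x = 1 / sqrt (1 + s^2)], dilating [k] and [s] by [a]
   multiplies the derivative of [k * arctn (k^2 - 1) x] by
   [a / sqrt (x^2 + a^2 (1 - x^2)) > 1]. *)
Lemma arctn_dilation k s a : 0 < k -> 0 < s -> 1 < a ->
  arctn (k ^+ 2 - 1) (Num.sqrt (1 + s ^+ 2))^-1 <
  a * arctn ((a * k) ^+ 2 - 1) (Num.sqrt (1 + (a * s) ^+ 2))^-1.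
Proof.
move=> k0 s0 a1; have a0 : 0 < a by lra.
pose u x := x ^+ 2 + a ^+ 2 * (1 - x ^+ 2).
(* [X] sends [1 / sqrt (1 + s^2)] to [1 / sqrt (1 + (a s)^2)]; see [Xx] below. *)
pose X x := x * (Num.sqrt (u x))^-1.
have x2le x : 0 <= x <= 1 -> 0 <= x ^+ 2 <= 1.
  by move=> /andP[x0 x1]; rewrite sqr_ge0 expr_le1.
have a2 : 1 < a ^+ 2 by rewrite exprn_egt1.
have u0 x : 0 <= x <= 1 -> 0 < u x by move=> /x2le /andP[h h']; rewrite /u; nra.
have su0 x : 0 <= x <= 1 -> 0 < Num.sqrt (u x) by move=> /u0; rewrite sqrtr_gt0.
have suu x : 0 <= x <= 1 -> Num.sqrt (u x) ^+ 2 = u x.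
  by move=> /u0 /ltW; exact: sqr_sqrtr.
have X01 x : 0 <= x <= 1 -> 0 <= X x <= 1.
  move=> x01; have sp := su0 x x01; have /andP[x0 x1] := x01.
  rewrite /X mulr_ge0 ?invr_ge0 ?(ltW sp) //= ler_pdivrMr // mul1r.
  rewrite -(ler_pXn2r (n := 2)) ?nnegrE ?(ltW sp) // suu // /u.
  by have /andP[h h'] := x2le x x01; rewrite lerDl mulr_ge0 ?sqr_ge0 ?subr_ge0.
have dX x : 0 <= x <= 1 -> is_derive x 1 X (a ^+ 2 / (Num.sqrt (u x) * u x)).
  move=> x01; have sp := su0 x x01; have up := u0 x x01.
  have dx2 : is_derive x 1 (fun x => x ^+ 2) (1 * x + x * 1).
    have -> : (fun x : R => x ^+ 2) = (fun x => x * x) by apply/funext => y; rewrite expr2.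
    by apply: (derM (is_derive_id _ _) (is_derive_id _ _)).
  have du := derD dx2 (derZ (a ^+ 2) (derB (der_cst 1 x) dx2)).
  have dsu := @der_comp _ _ u x _ _ (is_derive1_sqrt up) du.
  have := derM (is_derive_id x (1 : R))
    (@derV _ (fun t => Num.sqrt (u t)) x _ (lt0r_neq0 sp) dsu).
  move/is_derive_eq; apply.
  rewrite (_ : _ * u x = Num.sqrt (u x) ^+ 3); last by rewrite [RHS]exprS suu.
  have := suu x x01; rewrite /u; set q := Num.sqrt _ => qq.
  have q0 : q != 0 by rewrite lt0r_neq0.
  transitivity ((q ^+ 2 + x ^+ 2 * (a ^+ 2 - 1)) / q ^+ 3); first by field.
  rewrite [in LHS]qq (_ : _ + x ^+ 2 * _ = a ^+ 2); last by ring.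
  by [].
(* [E] vanishes at [0], and [dE] is positive on []0, 1[] because [u x < a ^+ 2] there; the mean
   value theorem then gives the claim. *)
pose E x := a * arctn ((a * k) ^+ 2 - 1) (X x) - arctn (k ^+ 2 - 1) x.
pose dE x := (a / Num.sqrt (u x) - 1) / (1 + (k ^+ 2 - 1) * x ^+ 2).
have EE x : 0 <= x <= 1 -> is_derive x 1 E (dE x).
  move=> x01; have sp := su0 x x01; have up := u0 x x01.
  have p1 := unit_pos k0 x01.
  have p2 := unit_pos (mulr_gt0 a0 k0) (X01 x x01).
  have := derB (derZ a (@der_comp _ _ X x _ _ (is_derive_arctn p2) (dX x x01)))
    (is_derive_arctn p1).
  move/is_derive_eq; apply.
  have -> : 1 + ((a * k) ^+ 2 - 1) * X x ^+ 2 =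
            a ^+ 2 * (1 + (k ^+ 2 - 1) * x ^+ 2) / u x.
    have -> : X x ^+ 2 = x ^+ 2 / u x by rewrite /X expr_div_n suu.
    by move: up; rewrite /u => up; field; rewrite gt_eqF.
  by rewrite /dE; field; rewrite !gt_eqF.
pose x := (Num.sqrt (1 + s ^+ 2))^-1.
have s2 : 0 < s ^+ 2 by rewrite exprn_gt0.
have q1 : 1 < Num.sqrt (1 + s ^+ 2) by rewrite -[ltLHS]sqrtr1 ltr_sqrt ?ltrDl ?addr_gt0.
have x0 : 0 < x by rewrite invr_gt0 (lt_trans ltr01).
have x1 : x < 1 by rewrite invf_lt1 // (lt_trans ltr01).
have Xx : X x = (Num.sqrt (1 + (a * s) ^+ 2))^-1.
  have xx : x ^+ 2 = (1 + s ^+ 2)^-1 by rewrite exprVn sqr_sqrtr // addr_ge0 ?ltW.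
  have p1 : 0 < 1 + s ^+ 2 by rewrite addr_gt0.
  have as0 : 0 < 1 + (a * s) ^+ 2 by rewrite ltr_pwDl // sqr_ge0.
  have ux : u x = (1 + (a * s) ^+ 2) * x ^+ 2.
    by rewrite /u xx; field; rewrite gt_eqF.
  rewrite /X ux sqrtrM ?(ltW as0) // sqrtr_sqr gtr0_norm //.
  have ras0 : 0 < Num.sqrt (1 + (a * s) ^+ 2) by rewrite sqrtr_gt0.
  by clearbody x; field; rewrite !gt_eqF.
rewrite -subr_gt0 -Xx -/x -/(E x).
have EE' t : t \in `[0, x] -> is_derive t 1 E (dE t).
  by rewrite in_itv /= => /andP[t0 tx]; apply: EE; rewrite t0 (le_trans tx) ?ltW.
have [c] := MVT_segment x0 EE'.
rewrite in_itv /= => /andP[c0 cx].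
have -> : E 0 = 0 by rewrite /E /X mul0r !arctn0 mulr0 subr0.
have c01 : 0 <= c <= 1 by rewrite !ltW // (lt_trans cx).
rewrite !subr0 => ->; rewrite mulr_gt0 // /dE divr_gt0 ?unit_pos // subr_gt0.
rewrite ltr_pdivlMr ?su0 // mul1r -(ltr_pXn2r (n := 2)) ?nnegrE ?(ltW a0) ?sqrtr_ge0 //.
rewrite suu // /u; have : 0 < c ^+ 2 by rewrite exprn_gt0.
by nra.
Qed.

End Arctn.

(** * Length of an arc inside the dual circle *)

Section Arcs.
Context {R : realType}.
Implicit Types (c N p q : vec R) (k K s l t : R).

(* The half-angle substitution [X = n / d] linearizes the flow: [arctn kappa X]
   grows at constant rate [1/2] from [0] to [arctn kappa (1 / K)]. *)
Lemma profile_length kappa K l (z Z : R -> R) :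
  0 < l -> 0 < K -> 0 < kappa + K ^+ 2 ->
  (forall t, t \in `[0, l] -> is_derive t 1 z (Z t)) ->
  (forall t, t \in `[0, l] -> is_derive t 1 Z (- (kappa * z t + K))) ->
  (forall t, t \in `[0, l] -> 0 <= z t) ->
  (forall t, t \in `[0, l] -> Z t ^+ 2 = 1 - kappa * z t ^+ 2 - 2 * K * z t) ->
  z 0 = 0 -> z l = 0 -> Z 0 = 1 -> Z l = -1 ->
  l = 2 * arctn kappa K^-1.
Proof.
move=> l0 K0; set L := kappa + K ^+ 2 => L0 dz dZ z_ge0 energy z0 zl Z0 Zl.
pose n t := kappa * z t + K - K * Z t.
pose d t := L + (K * (kappa * z t + K) + kappa * Z t).
have dn t : t \in `[0, l] -> is_derive t 1 n (d t - L).
  move=> tl; have := derB (derD (derZ kappa (dz t tl)) (der_cst K t)) (derZ K (dZ t tl)).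
  by move/is_derive_eq; apply; rewrite /d; ring.
have dd t : t \in `[0, l] -> is_derive t 1 d (- (kappa * n t)).
  move=> tl; have := derD (der_cst L t) (derD (derZ K (derD (derZ kappa (dz t tl))
    (der_cst K t))) (derZ kappa (dZ t tl))).
  by move/is_derive_eq; apply; rewrite /n; ring.
(* This conserved relation makes the derivative of [n / d] equal to [L / d] and
   [1 + kappa * (n / d) ^+ 2] equal to [2 * L / d], whence the constant rate in [dW]. *)
have nd t : t \in `[0, l] -> d t ^+ 2 + kappa * n t ^+ 2 = 2 * L * d t.
  move=> tl; have := energy t tl; rewrite /d /n /L => e.
  apply/eqP; rewrite -subr_eq0; apply/eqP.
  transitivity ((kappa ^+ 2 + kappa * K ^+ 2) *
    (Z t ^+ 2 - (1 - kappa * z t ^+ 2 - 2 * K * z t))); last by rewrite e; ring.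
  by ring.
have d0 : d 0 = L + L by rewrite /d z0 Z0 /L; ring.
have d_gt0 t : t \in `[0, l] -> 0 < d t.
  move=> tl; have [k0|k0] := leP 0 kappa.
    have zt := z_ge0 t tl; have e := energy t tl.
    have kz : 0 <= kappa * z t by rewrite mulr_ge0.
    have : `|Z t| <= 1.
      rewrite -(ler_pXn2r (n := 2)) ?nnegrE // -normrX e expr1n ger0_norm.
        by have := mulr_ge0 kz zt; have := mulr_ge0 (ltW K0) zt; lra.
      by rewrite -e sqr_ge0.
    rewrite ler_norml => /andP[Zt _]; rewrite /d /L.
    have : 0 <= kappa * (1 + Z t) by rewrite mulr_ge0 //; lra.
    by have := mulr_ge0 (ltW K0) kz; have := exprn_gt0 2 K0; lra.
  (* For negative [kappa], [d] starts at [2 * L] and cannot reach [L], where [nd] would read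
     [kappa * n ^+ 2 = L ^+ 2]. *)
  suff : 0 < d t - L by lra.
  have : 0 < d 0 - L by lra.
  have t0 : 0 <= t by move: tl; rewrite in_itv /= => /andP[].
  have sub x : x \in `[0, t] -> x \in `[0, l].
    move: tl; rewrite !in_itv /= => /andP[_ tl] /andP[-> xt]; exact: le_trans tl.
  have fd x : x \in `[0, t] -> is_derive x 1 (fun x => d x - L) (- (kappa * n x) - 0).
    by move=> /sub xl; exact: (derB (dd x xl) (der_cst L x)).
  apply: (continuous_away_gt t0 (der_continuous fd)).
  move=> x /sub xl; apply/eqP => dL.
  have := nd x xl; have -> : d x = L by lra.
  have := exprn_gt0 2 L0; have := sqr_ge0 (n x).
  by nra.
pose W t := arctn kappa (n t * (d t)^-1).
have dW t : t \in `[0, l] -> is_derive t 1 W (2^-1 : R).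
  move=> tl; have dt := d_gt0 t tl; have e := nd t tl.
  have pos : 1 + kappa * (n t * (d t)^-1) ^+ 2 = 2 * L / d t.
    transitivity ((d t ^+ 2 + kappa * n t ^+ 2) / d t ^+ 2); last rewrite e.
      by field; rewrite gt_eqF.
    by field; rewrite gt_eqF.
  have pos' : 0 < 1 + kappa * (n t * (d t)^-1) ^+ 2.
    by rewrite pos divr_gt0 // mulr_gt0.
  have dX := derM (dn t tl) (@derV _ d t _ (lt0r_neq0 dt) (dd t tl)).
  have := @der_comp _ _ (fun t => n t * (d t)^-1) t _ _ (is_derive_arctn pos') dX.
  move/is_derive_eq; apply; rewrite pos.
  transitivity ((2 * L / d t)^-1 *
     (((d t ^+ 2 + kappa * n t ^+ 2) - L * d t) / d t ^+ 2)).
    by field; rewrite !gt_eqF.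
  by rewrite e; field; rewrite !gt_eqF.
have [x _] := MVT_segment l0 dW.
have -> : W 0 = 0 by rewrite /W /n z0 Z0 (_ : _ - _ = 0) ?mul0r ?arctn0 //; ring.
(* At [l], where [z = 0] and [Z = -1], one has [n = 2 * K] and [d = 2 * K ^+ 2]. *)
rewrite !subr0 /W (_ : n l * _ = K^-1) => [->|]; first by field.
by rewrite /n /d /L zl Zl; field; rewrite ?gt_eqF //; have := exprn_gt0 2 K0; lra.
Qed.

Section Velocity.
Variables (gam : R -> vec R) (l : R).
Hypothesis gam_derivable :
  forall t i, 0 <= t <= l -> derivable (fun s : R => gam s 0 i) t 1.

Lemma velocity_derive t i : 0 <= t <= l ->
  is_derive t 1 (fun s => gam s 0 i) (velocity gam t 0 i).
Proof. by move=> tl; rewrite mxE derive1E; exact/derivableP/gam_derivable. Qed.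

Lemma mink_derive N t : 0 <= t <= l ->
  is_derive t 1 (fun s => mink N (gam s)) (mink N (velocity gam t)).
Proof.
move=> tl; exact: derB (derD (derZ _ (velocity_derive _ tl))
  (derZ _ (velocity_derive _ tl))) (derZ _ (velocity_derive _ tl)).
Qed.

Lemma mink_self_derive t : 0 <= t <= l ->
  is_derive t 1 (fun s => mink (gam s) (gam s)) (2 * mink (gam t) (velocity gam t)).
Proof.
move=> tl; have d i := velocity_derive i tl.
have := derB (derD (derM (d 1) (d 1)) (derM (d 2%:R) (d 2%:R))) (derM (d 0) (d 0)).
by move/is_derive_eq; apply; rewrite /mink; ring.
Qed.

Lemma mink_continuous N t : t <= l ->
  {within `[0, t], continuous (fun s => mink N (gam s))}.
Proof.
move=> tl; apply: (@der_continuous _ _ (fun t => mink N (velocity gam t))) => x.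
by rewrite in_itv /= => /andP[x0 xt]; apply: mink_derive; rewrite x0 (le_trans xt).
Qed.

End Velocity.

Lemma within_continuousM (A : set R) (f g : R -> R) :
  {within A, continuous f} -> {within A, continuous g} ->
  {within A, continuous (fun t => f t * g t)}.
Proof. by move=> fc gc x; apply: cvgM; [exact: fc|exact: gc]. Qed.

Lemma within_continuousD (A : set R) (f g : R -> R) :
  {within A, continuous f} -> {within A, continuous g} ->
  {within A, continuous (fun t => f t + g t)}.
Proof. by move=> fc gc x; apply: cvgD; [exact: fc|exact: gc]. Qed.

Lemma within_continuousB (A : set R) (f g : R -> R) :
  {within A, continuous f} -> {within A, continuous g} ->
  {within A, continuous (fun t => f t - g t)}.
Proof. by move=> fc gc x; apply: cvgB; [exact: fc|exact: gc]. Qed.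

(** By the intermediate value theorem an arc that misses a level set of [mink N] stays on one side
    of it. This carries an inequality from one tangency point to the next. *)
Lemma arc_away (A : set (vec R)) p q l N k : is_arc_of_length A p q l ->
  (forall x, A x -> mink N x != k) -> mink N p < k -> mink N q < k.
Proof.
move=> [l0 [gam [[<- <-] dgam _ _ [_ ->]]]] away.
rewrite -ltrN2 -[in X in _ -> X]ltrN2 -!minkNl.
apply: (@continuous_away_gt _ (fun t => mink (- N) (gam t)) 0 l (- k) l0).
  exact: (mink_continuous dgam (lexx l)).
by move=> x xl; rewrite minkNl eqr_opp away //; exists x.
Qed.

(* A unit-speed curve on [mink N x = - k] satisfies [gam' = e (gam x N)] with
   [e = 1] or [e = -1] constant, so that [z = s <c, gam> + K], which is nonnegative
   inside the dual circle, solves [z'' = (1 - k^2) z - K]. *)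
Lemma arc_length c N k K s (A : set (vec R)) p q l :
  mink c c = -1 -> 0 < s -> 0 < k -> 0 < K -> K ^+ 2 = 1 + s ^+ 2 ->
  mink N N = 1 - k ^+ 2 -> mink c N = - (k * K / s) ->
  (forall x, A x -> [/\ mink x x = -1, mink N x = - k & - (K / s) <= mink c x]) ->
  mink c p = - (K / s) -> mink c q = - (K / s) -> p != q ->
  is_arc_of_length A p q l ->
  l = 2 * arctn (k ^+ 2 - 1) K^-1 /\
  mink N (mcross c q) = - mink N (mcross c p).
Proof.
move=> cc s0 k0 K0 KK NN cN AE cp cq pq [l0 [gam [[gp gq] dgam vcont vv [_ AI]]]].
have {}l0 : 0 < l.
  rewrite lt_neqAle l0 andbT; apply/eqP => l00; move/eqP: pq; apply.
  by rewrite -gp -gq l00.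
have gA t : 0 <= t <= l -> A (gam t).
  by move=> tl; rewrite AI; exists t => //=; rewrite in_itv.
have gg t : 0 <= t <= l -> mink (gam t) (gam t) = -1 by move=> /gA /AE [].
have Ng t : 0 <= t <= l -> mink N (gam t) = - k by move=> /gA /AE [].
have cg t : 0 <= t <= l -> - (K / s) <= mink c (gam t) by move=> /gA /AE [].
have gv t : 0 <= t <= l -> mink (velocity gam t) (gam t) = 0.
  move=> tl; have := der_const l0 gg tl (mink_self_derive dgam tl).
  by rewrite minkC => /eqP; rewrite mulf_eq0 pnatr_eq0 => /eqP.
have Nv t : 0 <= t <= l -> mink (velocity gam t) N = 0.
  by move=> tl; have := der_const l0 Ng tl (mink_derive dgam N tl); rewrite minkC.
pose e t := mink (velocity gam t) (mcross (gam t) N).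
have qq t : 0 <= t <= l -> mink (mcross (gam t) N) (mcross (gam t) N) = 1.
  by move=> tl; rewrite mink_cross gg // NN (minkC _ N) Ng //; ring.
have vE t : 0 <= t <= l -> velocity gam t = e t *: mcross (gam t) N.
  by move=> tl; have := perp_cross (gv t tl) (Nv t tl); rewrite qq // scale1r.
have ee t : 0 <= t <= l -> e t ^+ 2 = 1.
  by move=> tl; have := vv t tl; rewrite vE // !minkE qq // mulr1 expr2.
have e_cont : {within `[0, l], continuous e}.
  have gc j : {within `[0, l], continuous (fun t => gam t 0 j)}.
      apply: (@der_continuous _ _ (fun t => velocity gam t 0 j)) => x xl.
      by apply: (velocity_derive dgam); move: xl; rewrite in_itv.
    have cc' (r : R) : {within `[0, l], continuous (fun=> r)} by move=> x; exact: cvg_cst.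
    have lin (x y : R) j j' :
        {within `[0, l], continuous (fun t => gam t 0 j * x - gam t 0 j' * y)}.
      by apply: within_continuousB; apply: within_continuousM; rewrite ?gc ?cc'.
    have wc0 : {within `[0, l], continuous (fun t => mcross (gam t) N 0 0)}.
      rewrite (_ : (fun t => _) = fun t => gam t 0 2%:R * N 0 1 - gam t 0 1 * N 0 2%:R) //.
      by apply/funext => t; case: (mcrossE (gam t) N).
    have wc1 : {within `[0, l], continuous (fun t => mcross (gam t) N 0 1)}.
      rewrite (_ : (fun t => _) = fun t => gam t 0 2%:R * N 0 0 - gam t 0 0 * N 0 2%:R) //.
      by apply/funext => t; case: (mcrossE (gam t) N).
    have wc2 : {within `[0, l], continuous (fun t => mcross (gam t) N 0 2%:R)}.
      rewrite (_ : (fun t => _) = fun t => gam t 0 0 * N 0 1 - gam t 0 1 * N 0 0) //.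
      by apply/funext => t; case: (mcrossE (gam t) N).
    by apply: within_continuousB; [apply: within_continuousD|]; apply: within_continuousM.
(* [e] is continuous with square [1], so [e 0 * e x] never vanishes and keeps its sign. *)
have ec t : 0 <= t <= l -> e t = e 0.
  move=> tl; have /andP[t0 tl'] := tl; have e00 : e 0 ^+ 2 = 1 by rewrite ee // lexx ltW.
  have : 0 < e 0 * e 0 by rewrite -expr2 e00.
  have fc : {within `[0, t], continuous (fun x => e 0 * e x)}.
    apply: within_continuousM; first by move=> x; exact: cvg_cst.
    apply: continuous_subspaceW e_cont => x /=; rewrite !in_itv /= => /andP[-> xt].
    exact: le_trans tl'.
  move=> /(continuous_away_gt t0 fc) h.
  have {h} h : 0 < e 0 * e t.
    apply: h => x; rewrite in_itv /= => /andP[x0 xt].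
    rewrite -sqrf_eq0 exprMn e00 ee ?mulr1 ?oner_eq0 //.
    by rewrite x0 (le_trans xt).
  have : (e 0 * e t) ^+ 2 = 1 by rewrite exprMn e00 ee ?mulr1.
  move/eqP; rewrite sqrf_eq1 => /orP[/eqP h1|/eqP h1]; last by lra.
  by rewrite -[LHS]mul1r -e00 expr2 -mulrA h1 mulr1.
have e0 : e 0 ^+ 2 = 1 by rewrite ee // lexx ltW.
(* [B] is the derivative of [a]. It is a determinant up to sign, so [gram3] expresses its square
   through [a]; that is the first integral [BB]. *)
pose a t := mink c (gam t).
pose B t := mink (e 0 *: mcross N c) (gam t).
have da t : 0 <= t <= l -> is_derive t 1 a (B t).
  move=> tl; have := mink_derive dgam c tl; move/is_derive_eq; apply.
  by rewrite vE // ec // /B !minkE (minkC c) mink_crossA minkC.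
have dB t : 0 <= t <= l -> is_derive t 1 B ((1 - k ^+ 2) * a t - k ^+ 2 * K / s).
  move=> tl; have := mink_derive dgam (e 0 *: mcross N c) tl; move/is_derive_eq; apply.
  rewrite vE // ec // !minkE mink_cross mulrA -expr2 e0 NN cN Ng // -/(a t).
  by field; rewrite gt_eqF.
have BB t : 0 <= t <= l -> B t ^+ 2 =
    (1 - k ^+ 2) * a t ^+ 2 - k ^+ 2 - (k * K / s) ^+ 2 - (1 - k ^+ 2) -
    2 * k ^+ 2 * K / s * a t.
  move=> tl; rewrite /B minkZl exprMn e0 gram3 NN cc gg // (minkC N c) cN Ng // -/(a t).
  by field; rewrite gt_eqF.
have l01 : 0 <= (0 : R) <= l by rewrite lexx ltW.
have l11 : 0 <= l <= l by rewrite lexx ltW.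
have a0 : a 0 = - (K / s) by rewrite /a gp.
have al : a l = - (K / s) by rewrite /a gq.
(* Inside the dual circle [a] is smallest at the two ends. This fixes the signs of [Z] there, which
   the first integral leaves open. *)
have B0 : 0 <= B 0 by apply: (der_ge0_right l0 _ (da 0 l01)) => t /cg; rewrite a0.
have Bl : B l <= 0 by apply: (der_le0_left l0 _ (da l l11)) => t /cg; rewrite al.
pose z t := s * a t + K; pose Z t := s * B t.
have ZZ t : 0 <= t <= l -> Z t ^+ 2 = 1 - (k ^+ 2 - 1) * z t ^+ 2 - 2 * K * z t.
  move=> tl; rewrite /Z /z exprMn BB //.
  apply/eqP; rewrite -subr_eq0; apply/eqP.
  transitivity (K ^+ 2 - (1 + s ^+ 2)); last by rewrite KK subrr.
  by field; rewrite gt_eqF.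
have z0 : z 0 = 0 by rewrite /z a0; field; rewrite gt_eqF.
have zl : z l = 0 by rewrite /z al; field; rewrite gt_eqF.
have Z0 : Z 0 = 1.
  have := ZZ 0 l01; rewrite z0 expr0n /= !mulr0 !subr0 => /eqP.
  rewrite sqrf_eq1 => /orP[/eqP //|/eqP h].
  by have : 0 <= Z 0; [rewrite mulr_ge0 // ltW|lra].
have Zl : Z l = -1.
  have := ZZ l l11; rewrite zl expr0n /= !mulr0 !subr0 => /eqP.
  rewrite sqrf_eq1 => /orP[/eqP h|/eqP //].
  by have : Z l <= 0; [rewrite mulr_ge0_le0 // ltW|lra].
have dz t : t \in `[0, l] -> is_derive t 1 z (Z t).
  rewrite in_itv => tl; have := derD (derZ s (da t tl)) (der_cst K t).
  by move/is_derive_eq; apply; rewrite addr0.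
have dZ t : t \in `[0, l] -> is_derive t 1 Z (- ((k ^+ 2 - 1) * z t + K)).
  rewrite in_itv => tl; have := derZ s (dB t tl); move/is_derive_eq; apply.
  by rewrite /z; field; rewrite gt_eqF.
have z_ge0 t : t \in `[0, l] -> 0 <= z t.
  rewrite in_itv => /cg h; rewrite /z; have := ler_wpM2l (ltW s0) h; rewrite -/(a t).
  by rewrite mulrN mulrCA divff ?gt_eqF // mulr1; lra.
have L0 : 0 < k ^+ 2 - 1 + K ^+ 2.
  by rewrite KK; have := exprn_gt0 2 k0; have := exprn_gt0 2 s0; lra.
split; first exact: (profile_length l0 K0 L0 dz dZ z_ge0 ZZ z0 zl Z0 Zl).
(* Up to the factor [e 0], the end values of [B] are the determinants of [N], [c] and the
   endpoints. *)
have hB : B l = - B 0.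
  by apply: (mulfI (lt0r_neq0 s0)); rewrite mulrN -/(Z l) -/(Z 0) Z0 Zl.
move: hB; rewrite /B gp gq !minkZl -!mink_crossA -mulrN => /(congr1 (fun r => e 0 * r)).
by rewrite !mulrA -expr2 e0 !mul1r.
Qed.

End Arcs.

(** * Tangency and the dual circle *)

Section DualCircle.
Context {R : realType}.
Implicit Types (c p q N : vec R) (C : gcircle R) (k K s : R).

Lemma dual_sqr K : 1 < K -> Num.sqrt (K ^+ 2 - 1) ^+ 2 = K ^+ 2 - 1.
Proof. by move=> K1; rewrite sqr_sqrtr // subr_ge0 exprn_ege1 // ltW. Qed.

Lemma dual_sqrt_gt0 K : 1 < K -> 0 < Num.sqrt (K ^+ 2 - 1).
Proof. by move=> K1; rewrite sqrtr_gt0 subr_gt0 exprn_egt1. Qed.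

Lemma gc_set_hplane C x : gc_set C x -> hplane x.
Proof. by case: C => [c k|n|n k] []. Qed.

Lemma dual_setP c K x : gc_wf (HCircle c K) -> gc_set (HCircle c K) x ->
  mink c x = - (K / Num.sqrt (K ^+ 2 - 1)).
Proof.
move=> wf xC; have hx := gc_set_hplane xC; have [_ K1] := wf.
have s0 := dual_sqrt_gt0 K1; move/(gc_setP wf hx): xC; rewrite /= minkZl => e.
by apply: (mulfI (lt0r_neq0 s0)); rewrite e mulrN mulrCA divff ?gt_eqF // mulr1.
Qed.

Lemma dual_disk_ge c K x : gc_wf (HCircle c K) ->
  (gc_disk (HCircle c K) `|` gc_set (HCircle c K)) x ->
  - (K / Num.sqrt (K ^+ 2 - 1)) <= mink c x.
Proof.
move=> wf [xD|/(dual_setP wf)-> //]; have hx : hplane x by case: xD.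
have [_ K1] := wf; have s0 := dual_sqrt_gt0 K1.
move/(gc_diskP wf hx): xD; rewrite /= minkZl => lt.
rewrite -(ler_pM2l s0) mulrN mulrCA divff ?gt_eqF // mulr1; exact: ltW.
Qed.

(** At [p] the two circles have tangent vectors [mcross c p] and [mcross (gc_normal C) p]; expanding
    their product by [mink_cross] leaves a linear equation for the value sought. *)
Lemma perpendicular_mink c K C p : gc_wf C -> gc_wf (HCircle c K) ->
  gc_set C p -> gc_set (HCircle c K) p -> perpendicular (HCircle c K) C ->
  mink c (gc_normal C) = - (gc_curv C * K / Num.sqrt (K ^+ 2 - 1)).
Proof.
move=> wf dwf pC pD [_ perp]; have hp := gc_set_hplane pC; have [pp _] := hp.
move/(gc_setP wf hp): (pC) => Np; have cp := dual_setP dwf pD.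
have : mink (mcross c p) (mcross (gc_normal C) p) = 0.
  apply: (perp p) => //; split=> /=; rewrite minkC ?mink_crossr ?mink_crossl //.
  by rewrite minkC; apply/(mink_gc_pole0 _ wf); rewrite minkC mink_crossl.
by rewrite mink_cross pp cp (minkC p) Np; lra.
Qed.

(* Both sides of a tangency point: [N] is recovered from its value [- k] at [p]
   and from the side [mink N (mcross c p)] of [p] on which its disk lies. *)
Lemma normal_at c p N k K s : 0 < s -> K ^+ 2 = 1 + s ^+ 2 ->
  mink c c = -1 -> mink p p = -1 -> mink c p = - (K / s) -> mink N p = - k ->
  mink N N = 1 - k ^+ 2 -> mink c N = - (k * K / s) ->
  (s * mink N (mcross c p)) ^+ 2 = 1 /\
  N = k *: p + (s * mink N (mcross c p)) *: (s *: mcross c p).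
Proof.
move=> s0 KK cc pp cp Np NN cN.
have sn : s != 0 by rewrite gt_eqF.
have qq : mink (mcross c p) (mcross c p) = (s ^+ 2)^-1.
  rewrite mink_cross cc pp cp (minkC p) cp.
  transitivity ((K ^+ 2 - s ^+ 2) / s ^+ 2); first by field.
  by rewrite KK; field.
have v0 : mink (N - k *: p) c = 0.
  by rewrite minkBl minkZl minkC cN (minkC p) cp; field.
have v1 : mink (N - k *: p) p = 0 by rewrite minkBl minkZl Np pp; ring.
have := perp_cross v0 v1.
have -> : mink (N - k *: p) (mcross c p) = mink N (mcross c p).
  by rewrite minkBl minkZl (minkC p) mink_crossr mulr0 subr0.
rewrite qq => /(congr1 (fun v => s ^+ 2 *: v)); rewrite !scalerA divff ?expf_neq0 //.
rewrite scale1r => e; split; last first.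
  rewrite (_ : _ * _ * s = s ^+ 2 * mink N (mcross c p)); last by ring.
  by rewrite -e addrC subrK.
have := congr1 (fun v => mink v v) e; rewrite /= !minkE qq NN pp (minkC p) Np.
set d := mink N (mcross c p) => h.
rewrite exprMn; transitivity (s ^+ 2 * d * (s ^+ 2 * d * (s ^+ 2)^-1)); first by field.
by rewrite -h; ring.
Qed.

(** By [normal_at] the two sides agree up to sign. If they were equal, both disks would lie in the
    same direction [w] from [p] and would share a point near [p]. *)
Lemma tangent_opposite c K C C' p : gc_wf C -> gc_wf C' -> gc_wf (HCircle c K) ->
  externally_tangent_at C C' p -> gc_set (HCircle c K) p ->
  perpendicular (HCircle c K) C -> perpendicular (HCircle c K) C' ->
  mink (gc_normal C') (mcross c p) = - mink (gc_normal C) (mcross c p).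
Proof.
move=> wf wf' dwf [inter disj] pD perp perp'.
have [pC pC'] : (gc_set C `&` gc_set C') p by rewrite inter.
have hp := gc_set_hplane pC; have [pp _] := hp; have [[cc _] K1] := dwf.
set s := Num.sqrt (K ^+ 2 - 1).
have s0 : 0 < s := dual_sqrt_gt0 K1.
have KK : K ^+ 2 = 1 + s ^+ 2 by rewrite /s dual_sqr //; ring.
have cp : mink c p = - (K / s) := dual_setP dwf pD.
have Np := iffLR (gc_setP wf hp) pC; have Np' := iffLR (gc_setP wf' hp) pC'.
have [dd NE] := normal_at s0 KK cc pp cp Np (mink_gc_normal wf)
  (perpendicular_mink wf dwf pC pD perp).
have [dd' NE'] := normal_at s0 KK cc pp cp Np' (mink_gc_normal wf')
  (perpendicular_mink wf' dwf pC' pD perp').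
have : (s * mink (gc_normal C') (mcross c p)) ^+ 2 =
  (s * mink (gc_normal C) (mcross c p)) ^+ 2 by rewrite dd dd'.
move/eqP; rewrite eqf_sqr => /orP[/eqP e|/eqP e]; last first.
  by apply: (mulfI (lt0r_neq0 s0)); rewrite mulrN.
exfalso; rewrite e in NE'.
set d := s * mink (gc_normal C) _ in dd NE NE'.
set w := d *: (s *: mcross c p) in NE NE'.
have wp : mink w p = 0 by rewrite !minkZl mink_crossr !mulr0.
have ww : mink w w = 1.
  rewrite /w !minkE mink_cross cc pp cp (minkC p) cp.
  transitivity (d ^+ 2 * (K ^+ 2 - s ^+ 2)); first by field; rewrite gt_eqF.
  by rewrite dd KK; ring.
clearbody w.
(* [r] dominates both curvatures, so that [k * t < 1] for each of them. *)
pose r := 1 + gc_curv C ^+ 2 + gc_curv C' ^+ 2; pose t := (2 * r)^-1.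
have r1 : 1 <= r by rewrite /r -addrA lerDl addr_ge0 ?sqr_ge0.
have tr : t * (2 * r) = 1 by rewrite mulVf // mulf_neq0 // gt_eqF //; lra.
have t0 : 0 < t by rewrite invr_gt0; lra.
have t1 : 2 * t <= 1 by nra.
have t2 : 0 < 1 - t ^+ 2 by nra.
(* The point at distance [2 artanh t] from [p] in direction [w], in the rational parametrization of
   the hyperbola. *)
pose x := (1 - t ^+ 2)^-1 *: ((1 + t ^+ 2) *: p + (2 * t) *: w).
have px : mink p x = - ((1 + t ^+ 2) / (1 - t ^+ 2)).
  by rewrite /x !minkE pp (minkC p) wp; field; rewrite gt_eqF.
have wx : mink w x = 2 * t / (1 - t ^+ 2).
  by rewrite /x !minkE wp ww; field; rewrite gt_eqF.
have xx : mink x x = -1.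
  rewrite {1}/x minkZl minkDl !minkZl px wx; field; rewrite gt_eqF //.
clearbody x.
have hx : hplane x.
  split=> //; apply: (mink_future hp); rewrite ?xx ?ltrN10 // px oppr_lt0 divr_gt0 //.
  by rewrite ltr_pwDl ?sqr_ge0.
have disk (k : R) : k ^+ 2 <= r -> - k < mink (k *: p + w) x.
  move=> kr; rewrite minkDl minkZl px wx -subr_gt0.
  rewrite (_ : _ - _ = 2 * t * (1 - k * t) / (1 - t ^+ 2)); last by field; rewrite gt_eqF.
  have kt : 0 < 1 - k * t by have := sqr_ge0 (k - 1); nra.
  by rewrite divr_gt0 // mulr_gt0 // mulr_gt0.
suff : (gc_disk C `&` gc_disk C') x by rewrite disj.
split; apply/gc_diskP => //.
  by rewrite NE; apply: disk; rewrite /r; have := sqr_ge0 (gc_curv C'); lra.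
by rewrite NE'; apply: disk; rewrite /r; have := sqr_ge0 (gc_curv C); lra.
Qed.

End DualCircle.

(** * Angle sum around the dual circle *)

Section AngleSum.
Context {R : realType}.
Variables (c : vec R) (K s d : R).
Hypotheses (cc : mink c c = -1) (s_gt0 : 0 < s) (KK : K ^+ 2 = 1 + s ^+ 2)
  (dd : d ^+ 2 = 1).
Implicit Types (p q N : vec R) (k t : R).

(* For [p] on the dual circle, an orthonormal frame of the plane orthogonal to its
   center [c]. *)
Definition radial p := s *: p - K *: c.
Definition tangential p := s *: mcross c p.

Let sn0 : s != 0. Proof. by rewrite gt_eqF. Qed.

Let cross_radial p : mcross c (radial p) = tangential p.
Proof. by apply: vec3P; rewrite !mxE /=; ring. Qed.

Let cross_tangential p : mink c p = - (K / s) -> mcross c (tangential p) = - radial p.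
Proof.
move=> cp; rewrite /tangential mcrossZr mcross_mcross cc cp /radial.
rewrite scalerBr !scalerA mulrN1 scaleNr mulrN mulrCA divff // mulr1 scaleNr.
by rewrite opprK opprB addrC.
Qed.

Let cross_frame p a b : mink c p = - (K / s) ->
  mcross c (a *: radial p + b *: tangential p) = a *: tangential p - b *: radial p.
Proof.
move=> cp; rewrite mcrossDr (mcrossZr a) (mcrossZr b) cross_radial.
by rewrite cross_tangential // scalerN.
Qed.

(** The two expressions of [N] show that rotating the frame at [p] by [t] one way and the frame at
    [q] by [t] the other way gives the same vector ([e1]). Crossing with [c] gives the other frame
    vector ([e2]), so the frames differ by the angle [t + t]. *)
Lemma rotation_step p q N k t : mink c p = - (K / s) -> mink c q = - (K / s) ->
  N = k *: p + d *: tangential p -> N = k *: q - d *: tangential q ->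
  k * sin t = s * cos t ->
  radial p = cos (t + t) *: radial q - (d * sin (t + t)) *: tangential q /\
  tangential p = cos (t + t) *: tangential q + (d * sin (t + t)) *: radial q.
Proof.
move=> cp cq Np Nq kt; rewrite cosD sinD.
have cs : cos t ^+ 2 + sin t ^+ 2 = 1 by rewrite cos2Dsin2.
set C := cos t in kt cs *; set S := sin t in kt cs *.
have e1 : C *: radial p + (S * d) *: tangential p =
          C *: radial q - (S * d) *: tangential q.
  (* Since [S * k = C * s], subtracting [C * K] times [c] turns [S * k] times [p] into [C] times
     [radial p]. *)
  have := congr1 (fun v => S *: v - (C * K) *: c) (esym Np); rewrite Nq /radial.
  rewrite scalerBr scalerDr !scalerBr !scalerA (mulrC S k) kt (mulrC C s) => e.
  by rewrite addrAC e addrAC.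
have e2 : C *: tangential p - (S * d) *: radial p =
          C *: tangential q + (S * d) *: radial q.
  have := congr1 (mcross c) e1; rewrite -[in RHS]scaleNr.
  by rewrite !cross_frame // !scaleNr opprK.
have comb (x y x' y' : R) : C * x + S * d * y = C * x' - S * d * y' ->
    C * y - S * d * x = C * y' + S * d * x' ->
    x = (C * C - S * S) * x' - d * (S * C + C * S) * y' /\
    y = (C * C - S * S) * y' + d * (S * C + C * S) * x'.
  move=> h1 h2; split.
    transitivity ((C ^+ 2 + S ^+ 2) * x + S ^+ 2 * (d ^+ 2 - 1) * x).
      by rewrite cs dd; ring.
    transitivity (C * (C * x + S * d * y) - S * d * (C * y - S * d * x)); first by ring.
    rewrite h1 h2; transitivity ((C * C - S * S * d ^+ 2) * x' - d * (S * C + C * S) * y').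
      by ring.
    by rewrite dd mulr1.
  transitivity ((C ^+ 2 + S ^+ 2) * y + S ^+ 2 * (d ^+ 2 - 1) * y).
    by rewrite cs dd; ring.
  transitivity (S * d * (C * x + S * d * y) + C * (C * y - S * d * x)); first by ring.
  rewrite h1 h2; transitivity ((C * C - S * S * d ^+ 2) * y' + d * (S * C + C * S) * x').
    by ring.
  by rewrite dd mulr1.
have coord i : _ := comb (radial p 0 i) (tangential p 0 i) (radial q 0 i) (tangential q 0 i).
have {}coord i :
    radial p 0 i = (C * C - S * S) * radial q 0 i - d * (S * C + C * S) * tangential q 0 i /\
    tangential p 0 i = (C * C - S * S) * tangential q 0 i + d * (S * C + C * S) * radial q 0 i.
  apply: coord; first by have /rowP/(_ i) := e1; rewrite !mxE.
  by have /rowP/(_ i) := e2; rewrite !mxE.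
by split; apply/rowP => i; have [h1 h2] := coord i; rewrite ?h1 ?h2 !mxE.
Qed.

Lemma rotation_inverse p q t :
  radial p = cos t *: radial q - (d * sin t) *: tangential q ->
  tangential p = cos t *: tangential q + (d * sin t) *: radial q ->
  radial q = cos (- t) *: radial p - (d * sin (- t)) *: tangential p /\
  tangential q = cos (- t) *: tangential p + (d * sin (- t)) *: radial p.
Proof.
move=> -> ->; rewrite cosN sinN; have cs : cos t ^+ 2 + sin t ^+ 2 = 1 by rewrite cos2Dsin2.
move: (cos t) (sin t) cs (radial q) (tangential q) => C S cs u w.
have one : C ^+ 2 + d ^+ 2 * S ^+ 2 = 1 by rewrite dd mul1r.
split; rewrite -[LHS]scale1r -one; apply/rowP => i; rewrite !mxE; ring.
Qed.

Let mink_radial q : mink q q = -1 -> mink c q = - (K / s) -> mink (radial q) q = s^-1.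
Proof.
move=> qq cq; rewrite /radial minkBl !minkZl qq cq.
transitivity ((K ^+ 2 - s ^+ 2) / s); first by field.
by rewrite KK; field.
Qed.

Let mink_tangential q : mink (tangential q) q = 0.
Proof. by rewrite minkZl mink_crossr mulr0. Qed.

(* [mink N q + k] is positive exactly when [q] lies in the disk of [N]. *)
Lemma mink_rotated p q N k t : mink p p = -1 -> mink q q = -1 ->
  mink c p = - (K / s) -> mink c q = - (K / s) ->
  N = k *: p + d *: tangential p ->
  radial p = cos t *: radial q - (d * sin t) *: tangential q ->
  tangential p = cos t *: tangential q + (d * sin t) *: radial q ->
  s ^+ 2 * (mink N q + k) = k * (cos t - 1) + s * sin t.
Proof.
move=> pp qq cp cq -> rp tp.
have rq := mink_radial qq cq; have tq := mink_tangential q.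
have pE : s *: p = radial p + K *: c by rewrite /radial subrK.
have : s * mink p q = cos t * s^-1 - K * (K / s).
  rewrite -minkZl pE rp minkDl minkBl (minkZl (cos t)) (minkZl (d * sin t)).
  by rewrite (minkZl K) rq tq cq; ring.
move=> e; rewrite minkDl (minkZl k) (minkZl d) tp minkDl (minkZl (cos t)).
rewrite (minkZl (d * sin t)) rq tq.
transitivity (k * (s * (s * mink p q) + s ^+ 2) + d ^+ 2 * s * sin t); first by field.
by rewrite e dd; transitivity (k * (cos t - (K ^+ 2 - s ^+ 2)) + s * sin t);
  [field|rewrite KK; ring].
Qed.

Lemma atan_ratio k : 0 < k -> [/\ k * sin (atan (s / k)) = s * cos (atan (s / k)),
  0 < atan (s / k) & atan (s / k) < pi / 2].
Proof.
move=> k0; split; last exact: atan_ltpi2.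
  have co : 0 < cos (atan (s / k)).
    by rewrite cos_gt0_pihalf // atan_gtNpi2 atan_ltpi2.
  have := atanK (s / k); rewrite /tan => e.
  have -> : sin (atan (s / k)) = s / k * cos (atan (s / k)).
    by rewrite -{2}e divfK // gt_eqF.
  by field; rewrite gt_eqF.
by rewrite -atan0 lt_atan // divr_gt0.
Qed.

Variables (p N : nat -> vec R) (k : nat -> R) (m : nat).
Hypotheses (k_gt0 : forall j, 0 < k j) (pp : forall j, mink (p j) (p j) = -1)
  (cp : forall j, mink c (p j) = - (K / s))
  (Np : forall j, N j = k j *: p j + d *: tangential (p j))
  (NSp : forall j, N j.+1 = k j.+1 *: p j - d *: tangential (p j)).

(** Half the angle spanned by circle [j] on the dual circle. Circle [j.+1] joins [p j] to [p j.+1],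
    hence the shifted index in [A], half the rotation between [p 0] and [p n]. *)
Let alpha j := atan (s / k j).
Let A n := \sum_(j < n) alpha j.+1.

(** In the formula of [mink_rotated] the angle is minus twice [alpha j.+1], which makes one term
    nonpositive and the other negative. *)
Lemma mink_consecutive j : mink (N j) (p j.+1) < - k j.
Proof.
have [kt a0 a1] := atan_ratio (k_gt0 j.+1).
have [rp tp] := rotation_step (cp j.+1) (cp j) (Np j.+1) (NSp j) kt.
have si : 0 < sin (alpha j.+1).
  by apply: sin_gt0_pi; rewrite a0 /= /alpha; have := pi_gt0 R; lra.
have co : 0 < cos (alpha j.+1).
  by apply: cos_gt0_pihalf; rewrite a1 andbT /alpha; have := pi_gt0 R; lra.
have [rp' tp'] := rotation_inverse rp tp.
have := mink_rotated (pp j) (pp j.+1) (cp j) (cp j.+1) (Np j) rp' tp'.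
rewrite cosN sinN sinD => e.
have : s ^+ 2 * (mink (N j) (p j.+1) + k j) < 0.
  rewrite e; have := mulr_gt0 s_gt0 (mulr_gt0 si co).
  have : k j * (cos (alpha j.+1 + alpha j.+1) - 1) <= 0.
    by apply: mulr_ge0_le0; [exact: ltW|rewrite subr_le0 cos_le1].
  rewrite -/(alpha j.+1); set C := cos (alpha _); set S := sin (alpha _); lra.
by rewrite pmulr_rlt0 ?exprn_gt0 // => h; lra.
Qed.

Lemma chain_rotation n :
  radial (p n) = cos (A n + A n) *: radial (p 0) - (d * sin (A n + A n)) *: tangential (p 0) /\
  tangential (p n) = cos (A n + A n) *: tangential (p 0) + (d * sin (A n + A n)) *: radial (p 0).
Proof.
elim: n => [|n [rn tn]].
  by rewrite /A big_ord0 addr0 cos0 sin0 mulr0 !scale0r !scale1r subr0 addr0.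
have [kt _ _] := atan_ratio (k_gt0 n.+1).
have [-> ->] := rotation_step (cp n.+1) (cp n) (Np n.+1) (NSp n) kt.
rewrite /A big_ord_recr -/(A n) /= -/(alpha n.+1) rn tn addrACA.
set x := A n + A n; set y := alpha _ + alpha _; rewrite (cosD x y) (sinD x y).
move: (cos x) (sin x) (cos y) (sin y) (radial (p 0)) (tangential (p 0)).
move=> cx sx cy sy u w.
have -> : cx * cy - sx * sy = cx * cy - d ^+ 2 * (sx * sy) by rewrite dd mul1r.
by split; apply/rowP => i; rewrite !mxE; ring.
Qed.

Let alpha_bounds j : 0 < alpha j < pi / 2.
Proof. by have [_ -> ->] := atan_ratio (k_gt0 j). Qed.

Let AS n : A n.+1 = A n + alpha n.+1.
Proof. by rewrite /A big_ord_recr. Qed.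

Let A0 : A 0 = 0. Proof. by rewrite /A big_ord0. Qed.

(* The closing condition [p m = p 0] makes the half-angle sum a positive multiple
   of [pi]; if it exceeded [pi], the arc on which the sum crosses [pi] would belong
   to a circle whose disk contains [p 0]. *)
Lemma angle_sum : (0 < m)%N -> p m = p 0 ->
  (forall j, (2 <= j < m)%N -> mink (N j) (p 0) < - k j) ->
  \sum_(j < m) atan (s / k j.+1) = pi.
Proof.
move=> m0 closed away; rewrite -/(A m).
have pi0 := pi_gt0 R.
have A_gt0 n : (0 < n)%N -> 0 < A n.
  case: n => // n _; elim: n => [|n IH]; rewrite AS ?A0 ?add0r.
    by have /andP[] := alpha_bounds 1.
  by rewrite addr_gt0 //; have /andP[] := alpha_bounds n.+2.
(* Closing up gives [cos (A m + A m) = 1]. *)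
have sinA : sin (A m) = 0.
  have [rm _] := chain_rotation m; rewrite closed in rm.
  have := congr1 (fun v => mink v (p 0)) rm.
  rewrite /= [RHS]minkBl (minkZl (cos _)) (minkZl (d * _)) mink_radial //.
  rewrite mink_tangential.
  rewrite mulr0 subr0 -[LHS]mul1r => /(mulIf (invr_neq0 sn0)).
  rewrite cosD => h; have := cos2Dsin2 (A m) => h'.
  by apply/eqP; rewrite -sqrf_eq0; apply/eqP; lra.
have Am : pi <= A m.
  rewrite leNgt; apply/negP => lt.
  by have := @sin_gt0_pi R (A m); rewrite A_gt0 // lt sinA ltxx => /(_ isT).
have ex : exists n, pi <= A n by exists m.
have [j piA jmin] := ex_minnP ex.
have jm := jmin m Am.
case: j => [|j] in piA jmin jm *; first by rewrite A0 in piA; lra.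
have Aj : A j < pi by rewrite ltNge; apply/negP => /jmin; rewrite ltnn.
have /andP[a0 a1] := alpha_bounds j.+1.
have x1 : A j.+1 - pi < alpha j.+1 by rewrite AS; lra.
have x0 : 0 <= A j.+1 - pi by lra.
have [lt|] := ltnP j.+1 m; last first.
  (* If [pi] is reached only at the last step, the overshoot is below [pi / 2] and has zero sine, so
     it is zero. *)
  move=> mj; have {mj jm} mj : m = j.+1 by apply/eqP; rewrite eqn_leq jm mj.
  rewrite mj in sinA *.
  have [//|/eqP xn] := eqVneq (A j.+1) pi.
  have : 0 < sin (A j.+1 - pi).
    apply: sin_gt0_pi; apply/andP; split; last by lra.
    by rewrite lt_neqAle x0 andbT eq_sym subr_eq0; apply/eqP.
  by rewrite sinB sinA cospi sinpi; lra.
(* One half-angle is below [pi / 2], so the first step cannot reach [pi]. *)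
have j2 : (2 <= j.+1 < m)%N.
  rewrite lt andbT; case: j Aj piA {jmin jm lt a0 a1 x1 x0} => // _.
  by rewrite AS A0; have /andP[] := alpha_bounds 1; lra.
have [rj tj] := chain_rotation j.+1.
have val := mink_rotated (pp j.+1) (pp 0) (cp j.+1) (cp 0) (Np j.+1) rj tj.
have [kt _ _] := atan_ratio (k_gt0 j.+1).
exfalso; have := away j.+1 j2; rewrite ltNge => /negP; apply.
rewrite -subr_ge0 opprK -(pmulr_rge0 _ (exprn_gt0 2 s_gt0)) val.
set x := A j.+1 - pi in x0 x1.
have -> : A j.+1 = x + pi by rewrite /x subrK.
rewrite -/(alpha j.+1) in kt; set al := alpha j.+1 in kt a0 a1 x1.
have sx : 0 <= sin x by apply: sin_ge0_pi; rewrite x0 /=; lra.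
have sal : 0 < sin al by apply: sin_gt0_pi; rewrite a0 /=; lra.
have : 0 <= sin (al - x) by apply: sin_ge0_pi; apply/andP; split; lra.
rewrite sinB => h.
rewrite (cosD (x + pi)) (sinD (x + pi)) (cosD x) (sinD x) cospi sinpi.
have cs := cos2Dsin2 x.
(* That is [tan x <= tan al = s / k]; multiplied by [sin al] it becomes [0 <= s * sin (al - x)]. *)
have : 0 <= s * cos x - k j.+1 * sin x.
  rewrite -(pmulr_rge0 _ sal).
  have -> : sin al * (s * cos x - k j.+1 * sin x) =
    s * (sin al * cos x - cos al * sin x)
    by rewrite !mulrBr mulrCA (mulrA _ (k _)) (mulrC _ (k _)) kt; ring.
  by rewrite mulr_ge0 // ltW.
move=> /(mulr_ge0 sx) ge0; rewrite [leRHS](_ : _ = 2 * (sin x * (s * cos x - k j.+1 * sin x))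
  + k j.+1 * (cos x ^+ 2 + sin x ^+ 2 - 1)); last by ring.
by rewrite cs subrr mulr0 addr0 mulr_ge0.
Qed.

End AngleSum.

(** * Packings *)

Section PackingFace.
Context {R : realType} {g n : nat} {D : cell_decomposition g n}.
Variables (k : vertex D -> R) (P : gc_packing k).
Hypothesis k_gt0 : forall v, 0 < k v.
Local Notation F := (@face g n D).
Implicit Types x y : dart D.

Lemma cell_face x : cell (face x) = cell x.
Proof.
by apply/eqP; rewrite eq_sym cellP; exact: fconnect1.
Qed.

Lemma cell_iter_face j x : cell (iter j F x) = cell x.
Proof. by elim: j => //= j <-; exact: cell_face. Qed.

Lemma order_face x : order F (face x) = order F x.
Proof.
by apply/esym/eq_card/same_connect; [exact: fconnect_sym (@face_inj _ _ D)|exact: fconnect1].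
Qed.

Lemma order_iter_face j x : order F (iter j F x) = order F x.
Proof. by elim: j => //= j <-; exact: order_face. Qed.

Variables (f : facet D) (c : vec R) (K : R).
Hypothesis dualE : pk_dual P f = HCircle c K.

(** The configuration can be listed from any dart of the face, so the facts below are read off with
    [x] at index 0. *)
Let conf x (xf : cell x = inl f) := pk_confP P xf.

Lemma order_ge3 x : cell x = inl f -> (3 <= order F x)%N.
Proof. by move=> xf; exact: conf_size (conf xf). Qed.

Let ord0F x (xf : cell x = inl f) : (0 < order F x)%N.
Proof. exact: leq_trans (order_ge3 xf). Qed.

Lemma dual_wf : gc_wf (HCircle c K).
Proof.
have [x xf] := cell_onto (inl f : facet D + 'I_n).
by rewrite -dualE; exact: conf_dual_wf (conf xf).
Qed.

Lemma circle_wf x : cell x = inl f -> gc_wf (pk_circle P x).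
Proof. by move=> xf; exact: (conf_wf (conf xf) (Ordinal (ord0F xf))). Qed.

Lemma circle_tangent x : cell x = inl f ->
  externally_tangent_at (pk_circle P x) (pk_circle P (face x)) (pk_tangency P x).
Proof.
move=> xf; have := conf_tangent (conf xf) (Ordinal (ord0F xf)).
by rewrite /= modn_small // (leq_trans _ (order_ge3 xf)).
Qed.

Lemma circle_disjoint x j : cell x = inl f -> (2 <= j)%N -> (j.+2 <= order F x)%N ->
  gc_set (pk_circle P x) `&` gc_set (pk_circle P (iter j F x)) = set0.
Proof.
move=> xf j2 jm; have jlt : (j < order F x)%N by rewrite (leq_trans _ jm).
have o3 := order_ge3 xf.
apply: (conf_disjoint (conf xf) (i := Ordinal (ord0F xf)) (j := Ordinal jlt)).
- by rewrite -val_eqE /= -lt0n (leq_trans _ j2).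
- by rewrite -val_eqE /= modn_small ?(leq_trans _ o3) // gtn_eqF.
- by rewrite -val_eqE /= modn_small.
Qed.

Lemma circle_no_triple x : cell x = inl f ->
  gc_set (pk_circle P x) `&` gc_set (pk_circle P (face x))
    `&` gc_set (pk_circle P (face (face x))) = set0.
Proof.
move=> xf; have o3 := order_ge3 xf.
exact: (conf_no_triple (conf xf) (i := Ordinal (ord0F xf))
  (j := Ordinal (leq_trans (isT : (1 < 3)%N) o3)) (l := Ordinal o3)).
Qed.

Lemma dual_tangency x : cell x = inl f -> gc_set (HCircle c K) (pk_tangency P x).
Proof.
by move=> xf; rewrite -dualE; exact: (conf_dual_tangency (conf xf) (Ordinal (ord0F xf))).
Qed.

Lemma dual_perpendicular x : cell x = inl f -> perpendicular (HCircle c K) (pk_circle P x).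
Proof.
by move=> xf; rewrite -dualE; exact: (conf_dual_perp (conf xf) (Ordinal (ord0F xf))).
Qed.

Let s := Num.sqrt (K ^+ 2 - 1).
Let N x := gc_normal (pk_circle P x).
Let p := pk_tangency P.

Lemma dual_curv_gt1 : 1 < K. Proof. by have [] := dual_wf. Qed.
Lemma dual_s_gt0 : 0 < s. Proof. exact: dual_sqrt_gt0 dual_curv_gt1. Qed.
Lemma sqr_dual_curv : K ^+ 2 = 1 + s ^+ 2.
Proof. by rewrite /s dual_sqr ?dual_curv_gt1 //; ring. Qed.
Lemma mink_dual_center : mink c c = -1. Proof. by have [[]] := dual_wf. Qed.

Lemma tangency_circles x : cell x = inl f ->
  gc_set (pk_circle P x) (p x) /\ gc_set (pk_circle P (face x)) (p x).
Proof.
move=> /circle_tangent[inter _].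
by have : (gc_set (pk_circle P x) `&` gc_set (pk_circle P (face x))) (p x) by rewrite inter.
Qed.

Lemma tangency_neq x : cell x = inl f -> p x != p (face x).
Proof.
move=> xf; have fxf : cell (face x) = inl f by rewrite cell_face.
apply/eqP => e; have [h1 h2] := tangency_circles xf; have [_ h3] := tangency_circles fxf.
have : (gc_set (pk_circle P x) `&` gc_set (pk_circle P (face x))
    `&` gc_set (pk_circle P (face (face x)))) (p x) by split=> //; rewrite e.
by rewrite circle_no_triple.
Qed.

Lemma mink_tangency x : cell x = inl f -> mink (p x) (p x) = -1.
Proof. by move=> /dual_tangency/gc_set_hplane[]. Qed.

Lemma mink_center_tangency x : cell x = inl f -> mink c (p x) = - (K / s).
Proof. by move=> /dual_tangency; exact: dual_setP dual_wf. Qed.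

Lemma mink_normal x : cell x = inl f -> mink (N x) (N x) = 1 - k (vert x) ^+ 2.
Proof. by move=> xf; rewrite mink_gc_normal ?(pk_curvP P xf) //; exact: circle_wf. Qed.

Lemma mink_center_normal x : cell x = inl f -> mink c (N x) = - (k (vert x) * K / s).
Proof.
move=> xf; rewrite -(pk_curvP P xf); have [h1 _] := tangency_circles xf.
exact: (perpendicular_mink (circle_wf xf) dual_wf h1 (dual_tangency xf)
  (dual_perpendicular xf)).
Qed.

Lemma mink_circle x q : cell x = inl f -> gc_set (pk_circle P x) q ->
  mink (N x) q = - k (vert x).
Proof.
move=> xf xq; rewrite -(pk_curvP P xf).
exact: iffLR (gc_setP (circle_wf xf) (gc_set_hplane xq)) xq.
Qed.

Lemma side_length x : cell x = inl f ->
  pk_length P (face x) = 2 * arctn (k (vert (face x)) ^+ 2 - 1) K^-1 /\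
  mink (N (face x)) (mcross c (p (face x))) = - mink (N (face x)) (mcross c (p x)).
Proof.
move=> xf; have fxf : cell (face x) = inl f by rewrite cell_face.
have K0 : 0 < K by rewrite (lt_trans _ dual_curv_gt1).
apply: (arc_length mink_dual_center dual_s_gt0 (k_gt0 _) K0 sqr_dual_curv
  (mink_normal fxf) (mink_center_normal fxf) _
  (mink_center_tangency xf) (mink_center_tangency fxf) (tangency_neq xf) (pk_lengthP P xf)).
move=> q [qC qD]; rewrite mink_circle //; split=> //; first by case: (gc_set_hplane qC).
by apply: dual_disk_ge dual_wf _; rewrite -dualE.
Qed.

Lemma tangency_opposite x : cell x = inl f ->
  mink (N (face x)) (mcross c (p x)) = - mink (N x) (mcross c (p x)).
Proof.
move=> xf; have fxf : cell (face x) = inl f by rewrite cell_face.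
exact: (tangent_opposite (circle_wf xf) (circle_wf fxf) dual_wf (circle_tangent xf)
  (dual_tangency xf) (dual_perpendicular xf) (dual_perpendicular fxf)).
Qed.

Lemma face_angle_sum x : cell x = inl f ->
  \sum_(j < order F x) atan (s / k (vert (iter j.+1 F x))) = pi.
Proof.
move=> xf; have jf j : cell (iter j F x) = inl f by rewrite cell_iter_face.
pose d := s * mink (N x) (mcross c (p x)).
(* The sign flips along each side ([side_length]) and again at each tangency point
   ([tangency_opposite]), so it is the same for all circles. *)
have dE j : s * mink (N (iter j F x)) (mcross c (p (iter j F x))) = d.
  elim: j => //= j IH; have [_ ->] := side_length (jf j).
  by rewrite (tangency_opposite (jf j)) opprK.
have normal j := normal_at dual_s_gt0 sqr_dual_curv mink_dual_center
  (mink_tangency (jf j)) (mink_center_tangency (jf j))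
  (mink_circle (jf j) (tangency_circles (jf j)).1)
  (mink_normal (jf j)) (mink_center_normal (jf j)).
have normalS j := normal_at dual_s_gt0 sqr_dual_curv mink_dual_center
  (mink_tangency (jf j)) (mink_center_tangency (jf j))
  (mink_circle (jf j.+1) (tangency_circles (jf j)).2)
  (mink_normal (jf j.+1)) (mink_center_normal (jf j.+1)).
have dd : d ^+ 2 = 1 by have [] := normal 0%N.
have Np j : N (iter j F x) = k (vert (iter j F x)) *: p (iter j F x) +
    d *: tangential c s (p (iter j F x)).
  by have [_ {1}->] := normal j; rewrite dE.
have NSp j : N (iter j.+1 F x) = k (vert (iter j.+1 F x)) *: p (iter j F x) -
    d *: tangential c s (p (iter j F x)).
  have [_ {1}->] := normalS j; rewrite [iter j.+1 F x]/= (tangency_opposite (jf j)).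
  by rewrite mulrN dE scaleNr.
have kj j : 0 < k (vert (iter j F x)) by [].
have closed : iter (order F x) F x = x by rewrite iter_order //; exact: face_inj.
apply: (@angle_sum _ c K s d mink_dual_center dual_s_gt0 sqr_dual_curv dd (fun j => p (iter j F x))
  (fun j => N (iter j F x)) (fun j => k (vert (iter j F x))) (order F x) kj
  (fun j => mink_tangency (jf j)) (fun j => mink_center_tangency (jf j)) Np NSp)
  => [||i /andP[i2 im]].
- exact: ord0F xf.
- by rewrite closed.
(* Starting from [mink_consecutive], go along the sides of the circles after [i.+1]. They are
   disjoint from circle [i] as far as the return to [p 0], because [2 <= i]. *)
have away e : (i + e.+1 <= order F x)%N ->
    mink (N (iter i F x)) (p (iter (i + e.+1) F x)) < - k (vert (iter i F x)).
  elim: e => [_|e IH le].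
    rewrite addn1; exact: (mink_consecutive mink_dual_center dual_s_gt0 sqr_dual_curv dd kj
      (fun j => mink_tangency (jf j)) (fun j => mink_center_tangency (jf j)) Np NSp).
  have {}IH : mink (N (iter i F x)) (p (iter (i + e.+1) F x)) < - k (vert (iter i F x)).
    by apply: IH; rewrite (leq_trans _ le) // leq_add2l.
  rewrite (addnS i e.+1) iterS; apply: (arc_away (pk_lengthP P (jf (i + e.+1)%N)) _ IH).
  move=> q [qC _]; apply/eqP => e'.
  have qi : gc_set (pk_circle P (iter i F x)) q.
    by apply/(gc_setP (circle_wf (jf i)) (gc_set_hplane qC)); rewrite (pk_curvP P (jf i)).
  have : (gc_set (pk_circle P (iter i F x)) `&`
          gc_set (pk_circle P (iter e.+2 F (iter i F x)))) q.
    by split=> //; rewrite -iterD addnC addnS.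
  rewrite circle_disjoint // order_iter_face (leq_trans _ le) //.
  by rewrite -[e.+4]/(2 + e.+2)%N leq_add2r.
have := away (order F x - i).-1; rewrite prednK ?subn_gt0 // subnKC ?(ltnW im) //.
by rewrite closed; apply.
Qed.

End PackingFace.

(** * Comparison of two packings *)

Section Comparison.
Context {R : realType} {g n : nat} {D : cell_decomposition g n}.
Implicit Types (k : vertex D -> R) (x : dart D) (f : facet D).

(** A single [s] serves the angle equation and all side lengths of the face. The dual is a genuine
    circle because its curvature exceeds [1]. *)
Lemma packing_face k (P : gc_packing k) f : (forall v, 0 < k v) ->
  exists2 s : R, 0 < s & forall x, cell x = inl f ->
    \sum_(j < order (@face g n D) x) atan (s / k (vert (iter j.+1 (@face g n D) x))) = pi /\
    pk_length P x = 2 * arctn (k (vert x) ^+ 2 - 1) (Num.sqrt (1 + s ^+ 2))^-1.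
Proof.
move=> k_gt0; have [x0 x0f] := cell_onto (inl f : facet D + 'I_n).
have := conf_dual_wf (pk_confP P x0f); have := conf_dual_curv (pk_confP P x0f).
case dualE : (pk_dual P f) => [c K|N|N K] /= K1; last 2 first.
- by move: K1; rewrite ltxx.
- by case=> _ _ /(lt_trans K1); rewrite ltxx.
move=> dwf; exists (Num.sqrt (K ^+ 2 - 1)); first exact: dual_s_gt0 dualE.
move=> x xf; split; first exact: (face_angle_sum k_gt0 dualE xf).
have <- : K = Num.sqrt (1 + Num.sqrt (K ^+ 2 - 1) ^+ 2).
  by rewrite -(sqr_dual_curv dualE) sqrtr_sqr gtr0_norm // (lt_trans _ K1).
have o3 := order_ge3 P xf.
(* [side_length] speaks of [face y], so [x] is written as the successor of its predecessor. *)
have xE : x = face (iter (order (@face g n D) x).-1 (@face g n D) x).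
  by rewrite -iterS prednK ?(leq_trans _ o3) // iter_order //; exact: face_inj.
have yf : cell (iter (order (@face g n D) x).-1 (@face g n D) x) = inl f.
  by rewrite cell_iter_face.
by have [] := side_length k_gt0 dualE yf; rewrite -xE.
Qed.

Lemma side_curvature_lt k k' (P : gc_packing k) (P' : gc_packing k') (M : R) x f :
  (forall v, 0 < k v) -> (forall v, 0 < k' v) -> 1 < M -> (forall v, k' v <= M * k v) ->
  cell x = inl f -> k' (vert x) = M * k (vert x) ->
  k (vert x) * pk_length P x < k' (vert x) * pk_length P' x.
Proof.
move=> k_gt0 k'_gt0 M1 kM xf kx; have M0 : 0 < M by lra.
have [s s0 /(_ x xf)[sumP ->]] := packing_face P f k_gt0.
have [s' s'0 /(_ x xf)[sumP' ->]] := packing_face P' f k'_gt0.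
have ss' : s' <= M * s.
  (* Otherwise every half-angle of [P'] would exceed that of [P], though both sums are [pi]. *)
  rewrite leNgt; apply/negP => lt.
  have : \sum_(j < order (@face g n D) x) atan (s / k (vert (iter j.+1 (@face g n D) x)))
      < \sum_(j < order (@face g n D) x) atan (s' / k' (vert (iter j.+1 (@face g n D) x))).
    apply: ltr_sum => [|j _].
      apply/hasP; exists (Ordinal (leq_trans (isT : (0 < 3)%N) (order_ge3 P xf)));
        by rewrite ?mem_index_enum.
    apply: lt_atan; set v := vert _.
    rewrite ltr_pdivlMr // mulrAC ltr_pdivrMr //.
    apply: (le_lt_trans (ler_wpM2l (ltW s0) (kM v))).
    by rewrite mulrA (mulrC s) ltr_pM2r.
  by rewrite sumP sumP' ltxx.
(* The middle term belongs to the dilated data [M * k] and [M * s]: [arctn_dilation] places it above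
   [P], and [ler_arctn] with [s' <= M * s] places it below [P']. *)
rewrite kx; apply: (@lt_le_trans _ _ (2 * (k (vert x) *
    (M * arctn ((M * k (vert x)) ^+ 2 - 1) (Num.sqrt (1 + (M * s) ^+ 2))^-1)))).
  by rewrite mulrCA ltr_pM2l // ltr_pM2l // arctn_dilation.
rewrite (_ : 2 * _ = M * k (vert x) * (2 * arctn ((M * k (vert x)) ^+ 2 - 1)
  (Num.sqrt (1 + (M * s) ^+ 2))^-1)); last by ring.
have q1 (r : R) : 1 <= Num.sqrt (1 + r ^+ 2).
  by rewrite -[leLHS]sqrtr1 ler_wsqrtr // lerDl sqr_ge0.
have q0 (r : R) : 0 < Num.sqrt (1 + r ^+ 2) by rewrite (lt_le_trans ltr01).
rewrite ler_pM2l ?mulr_gt0 // ler_pM2l //; apply: ler_arctn.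
- by rewrite mulr_gt0.
- by rewrite invr_ge0 ltW.
- rewrite lef_pV2 ?posrE // ler_wsqrtr // lerD2l ler_pXn2r // ?nnegrE ?ltW //.
  by rewrite mulr_gt0.
- by rewrite invf_le1.
Qed.

Lemma total_curvature_lt k k' (P : gc_packing k) (P' : gc_packing k') (M : R) v :
  (forall v, 0 < k v) -> (forall v, 0 < k' v) -> 1 < M -> (forall v, k' v <= M * k v) ->
  v \in interior_vertices D -> k' v = M * k v ->
  total_curvature P v < total_curvature P' v.
Proof.
move=> k_gt0 k'_gt0 M1 kM vi kv.
have [x xv] := vert_onto v.
(* An interior vertex has a corner in some 2-cell, so the sums are nonempty and the inequality stays
   strict. *)
have [f xf] : exists f, cell x = inl f.
  case E : (cell x) => [f|i]; first by exists f.
  move: vi; rewrite !finset.inE => /existsP[]; exists x; rewrite xv eqxx /=.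
  by apply/existsP; exists i; rewrite E.
apply: ltr_sum => [|h].
  apply/hasP; exists f; rewrite ?mem_index_enum //.
  by apply/imsetP; exists x; rewrite ?xv // !finset.inE xf eqxx.
move=> /imsetP[y]; rewrite !finset.inE => /eqP yh vy; apply: ltr_sum => [|z].
  by apply/hasP; exists y; rewrite ?mem_index_enum // -vy eqxx yh eqxx.
move=> /andP[/eqP zv /eqP zh]; rewrite (pk_curvP P zh) (pk_curvP P' zh).
by apply: (side_curvature_lt _ _ _ _ M1 kM zh) => //; rewrite zv.
Qed.

End Comparison.

(** * The maximum principle for the ratio of curvatures *)

Unset Implicit Arguments.

Theorem theorem7p5 (R : realType) (g n : nat) (n_ge1 : (1 <= n)%N)
  (D : cell_decomposition g n)
  (That : vertex D -> R)
  (That_gt0 : forall v, v \in interior_vertices D -> 0 < That v)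
  (That_lt : forall Q : {set vertex D},
     Q != finset.set0 -> Q \subset interior_vertices D ->
     \sum_(v in Q) That v <
     \sum_(f : facet D | (facet_vertices f :&: Q != finset.set0)%SET)
        pi * (minn #|(facet_vertices f :&: Q)%SET| (#|facet_vertices f| - 2))%:R)
  (k k' : vertex D -> R)
  (k_gt0 : forall v, 0 < k v) (k'_gt0 : forall v, 0 < k' v)
  (P : gc_packing k) (P' : gc_packing k')
  (k_le : forall w, w \in boundary_vertices D -> k w <= k' w)
  (T_k : forall v, v \in interior_vertices D -> total_curvature P v = That v)
  (T_k' : forall v, v \in interior_vertices D -> total_curvature P' v = That v)
  (phi : vertex D -> R) (phi_def : forall v, phi v = k' v / k v)
  (M : R) (M_attained : exists v, phi v = M) (M_max : forall v, phi v <= M) :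
  [/\ 1 <= M,
      1 < M -> forall v, phi v = M -> v \in boundary_vertices D
    & (exists2 v, v \in interior_vertices D & phi v = M) ->
      M = 1 /\ forall v, k v = k' v].
Proof.
have interiorVboundary v : (v \in interior_vertices D) || (v \in boundary_vertices D).
  by rewrite finset.in_setC orNb.
have k_kM v : k' v <= M * k v by rewrite -ler_pdivrMr // -phi_def.
have no_interior_max v : 1 < M -> v \in interior_vertices D -> phi v <> M.
  move=> M1 vi; rewrite phi_def => /(congr1 ( *%R^~ (k v))); rewrite divfK ?gt_eqF // => kv.
  have := total_curvature_lt P P' k_gt0 k'_gt0 M1 k_kM vi kv.
  by rewrite T_k // T_k' // ltxx.
(* As [n >= 1] there is a hole, hence a boundary vertex, where the ratio is at least [1]. *)
have M_ge1 : 1 <= M.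
  have [x xi] := cell_onto (inr (Ordinal n_ge1) : facet D + 'I_n).
  have xb : vert x \in boundary_vertices D.
    rewrite finset.inE; apply/existsP; exists x; rewrite eqxx /=.
    by apply/existsP; exists (Ordinal n_ge1); rewrite xi.
  by apply: le_trans (M_max (vert x)); rewrite phi_def ler_pdivlMr // mul1r k_le.
split=> // [M1 v vM|[v vi vM]].
  have /orP[vi|//] := interiorVboundary v.
  by case: (no_interior_max v M1 vi vM).
have M1 : M = 1.
  apply/eqP; rewrite eq_le M_ge1 andbT leNgt; apply/negP => M1.
  exact: no_interior_max M1 vi vM.
split=> // {v vi vM}.
have k'k v : k' v <= k v by rewrite -[leRHS]mul1r -M1.
(* Exchanging the roles of the packings bounds the ratio [k / k'] by [1]. *)
pose psi v := k v / k' v.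
have [x0 _] := cell_onto (inr (Ordinal n_ge1) : facet D + 'I_n).
have psi_max : exists v, forall w, psi w <= psi v.
  have [v _ vmax] := @Order.TotalTheory.arg_maxP _ _ _ (vert x0) xpredT psi isT.
  by exists v => w; exact: vmax.
have [v vmax] := psi_max.
have kpsi w : k w <= psi v * k' w by rewrite -ler_pdivrMr // vmax.
suff psi1 : psi v <= 1.
  move=> w; apply/eqP; rewrite eq_le k'k andbT (le_trans (kpsi w)) //.
  by rewrite ler_piMl // ltW.
(* At a boundary vertex [k <= k'] contradicts [1 < psi v]; at an interior one the exchanged
   comparison does. *)
rewrite leNgt; apply/negP => psi1; have /orP[vi|vb] := interiorVboundary v; last first.
  by move: psi1; rewrite /psi ltr_pdivlMr // mul1r ltNge k_le.
have kv : k v = psi v * k' v by rewrite /psi divfK // gt_eqF.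
have := total_curvature_lt P' P k'_gt0 k_gt0 psi1 kpsi vi kv.
by rewrite T_k // T_k' // ltxx.
Qed.
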